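(* There are absolute constants $c,\eta>0$ such that, for every prime $p$ and every integer $N$ with $1\le N\le p-3$, $$\left|\left\{\binom Nn\bmod p:0\le n\le N\right\}\right|\ge c(N+1)^{1/2+\eta}.$$ For the two remaining rows below $p$, $$\left|\left\{\binom{p-2}{n}\bmod p:0\le n\le p-2\right\}\right|=\frac{p-1}{2},$$ $$\left|\left\{\binom{p-1}{n}\bmod p:0\le n\le p-1\right\}\right|=2.$$
   Context: Here $p$ denotes a prime, $\binom{N}{n}$ is the usual binomial coefficient, and $|\{\cdot\}|$ is the number of distinct residue classes modulo $p$ in the indicated set. The ''two remaining rows below $p$'' are the rows $N=p-2$ and $N=p-1$ of Pascal's triangle.
   Formalization: The two exact formulas for the rows N = p-2 and N = p-1 are stated for odd primes p only; at p = 2 both printed formulas fail, since each of these rows has exactly one residue class (not 1/2 and not 2). *)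

(* Defs.v *)
From HB Require Import structures.
From mathcomp Require Import all_boot all_order all_algebra.
From mathcomp Require Import all_classical all_reals all_analysis.

Set Implicit Arguments.
Unset Strict Implicit.
Unset Printing Implicit Defensive.

Import Order.TTheory GRing.Theory Num.Theory.

Local Open Scope ring_scope.

(* The residue classes mod p occurring in row N of Pascal's triangle; 'F_p is
   the integers mod p only when p is prime. *)
Definition row_residues (p N : nat) : {set 'F_p} :=
  [set ('C(N, n)%:R : 'F_p) | n : 'I_N.+1].

(* Main.v *)
(* Put k = N + 2 and lambda = (N + 1)^2. Three consecutive entries a, b, c of
   row N satisfy (k a + b) (k c + b) = lambda b^2, that is, c = g_b(a) for a
   Moebius involution g_b attached to b. As consecutive ratios in the row are
   distinct, the set A of residues contains about N such triples; if |A| = n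
   were close to N^(1/2), then a positive proportion of all pairs (a, b) in A
   would have g_b(a) in A. Composing three involutions gives about n^3 words
   mapping a positive proportion of A into A, and each Moebius map comes from at
   most four words, so A contains almost n^7 pairs of quadruples with equal
   cross ratio. Moving a suitable point of A to infinity turns this into a set
   A' such that (1 - xi) a + xi a' lies in A' for many (a, a') and for almost n
   values of xi. By Balog-Szemeredi-Gowers and Pluennecke-Ruzsa, a subset B of a
   dilate of A' is then essentially preserved by addition and by many dilations,
   which is impossible in F_p when n is much smaller than p. All losses are
   powers of K = n^2 / N, so n is at most a power of K, which is the claim. *)
Require Import Defs.
From HB Require Import structures.
From mathcomp Require Import all_boot all_order all_algebra.
From mathcomp Require Import zify ring.

Set Implicit Arguments.
Unset Strict Implicit.
Unset Printing Implicit Defensive.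

Import Order.TTheory GRing.Theory Num.Theory.

Local Open Scope ring_scope.

(** * Sumsets *)

(** Three involutions are composed because PGL_2 has dimension three. A pair of quadruples with
    equal cross ratio is determined by seven of its eight entries, so a set of size n has at most
    n^7 such pairs; n^3 words acting on n^4 quadruples reach this maximum up to powers of K, whereas
    words of length two would stop at n^6. At the maximum, over a suitable base point, about n cross
    ratios are each attained by about n^2 quadruples, again the most possible, and this is what the
    additive part of the argument needs. The obstacle is that some words collapse: two equal
    neighbouring letters cancel and leave a single involution, which therefore has a large fibre.
    The collapsing words lie in three families with two free letters each, so they can be discarded;
    [generic] describes the others. In the sum-product step a prime field is distinguished only by
    the fact that 1 generates it additively, which rules out proper subfields. No constant is
    optimised: if n <= K^C, the exponent obtained is (C + 1) / (2C + 1) = 1/2 + 1 / (2 (2C + 1)). *)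

Definition sumset (V : finZmodType) (A B : {set V}) : {set V} :=
  [set a + b | a in A, b in B].

Definition diffset (V : finZmodType) (A B : {set V}) : {set V} :=
  [set a - b | a in A, b in B].

Lemma card_imset2_le (aT bT rT : finType) (f : aT -> bT -> rT)
    (A : {set aT}) (B : {set bT}) :
  (#|[set f a b | a in A, b in B]| <= #|A| * #|B|)%N.
Proof.
rewrite -cardsX; apply: (@leq_trans #|[set f u.1 u.2 | u in setX A B]|).
  apply/subset_leq_card/subsetP => _ /imset2P[a b aA bB ->].
  by apply/imsetP; exists (a, b) => //; rewrite inE; apply/andP.
exact: leq_imset_card.
Qed.

(** Fix one representation d = p - q for each difference. The map (d, x) -> (p + x, x + q) is
    injective: the difference of the coordinates returns d, and then p + x returns x. *)
Lemma ruzsa_triangle (V : finZmodType) (P Q X : {set V}) :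
  (#|diffset P Q| * #|X| <= #|sumset P X| * #|sumset X Q|)%N.
Proof.
have /fin_all_exists2[f fP fE] (d : V) : exists2 u : V * V,
    d \in diffset P Q -> (u.1 \in P) && (u.2 \in Q) &
    d \in diffset P Q -> d = u.1 - u.2.
  have [/imset2P[p q pP qQ ->]|nd] := boolP (d \in diffset P Q).
    by exists (p, q) => //= _; rewrite pP qQ.
  by exists (0, 0).
rewrite -!cardsX.
pose g (u : V * V) := ((f u.1).1 + u.2, u.2 + (f u.1).2).
have g_inj : {in setX (diffset P Q) X &, injective g}.
  move=> [d x] [d' x']; rewrite !inE /= => /andP[dD _] /andP[d'D _].
  rewrite /g /= => -[e1 e2].
  have ed : d = d'.
    rewrite (fE d dD) -(addrKA x) e1 e2 addrKA; apply: esym.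
    exact: fE d' d'D.
  by rewrite ed in e1 *; move/addrI: e1 => ->.
rewrite -(card_in_imset g_inj); apply/subset_leq_card/subsetP.
move=> _ /imsetP[[d x] /setXP /= [dD xX] ->].
have /andP[pP qQ] := fP d dD.
by rewrite inE /=; apply/andP; split; apply/imset2P;
  [exists (f d).1 x|exists x (f d).2].
Qed.

(* [X] is a maximal subset of [S] with pairwise disjoint translates x - B. *)
Lemma ruzsa_covering (V : finZmodType) (S B : {set V}) : B != set0 ->
  exists2 X : {set V}, (#|X| * #|B| <= #|diffset S B|)%N &
    forall s, s \in S -> exists x b1 b2,
      [/\ x \in X, b1 \in B, b2 \in B & s = x + b1 - b2].
Proof.
case/set0Pn => b0 b0B.
pose ok (X : {set V}) := (X \subset S) &&
  [forall x in X, forall y in X, forall b in B, forall c in B,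
     (x - b == y - c) ==> (x == y)].
have ok0 : ok set0.
  by rewrite /ok sub0set; apply/forall_inP => x; rewrite inE.
case: (maxset_exists ok0) => X /maxsetP[/andP[XS /forall_inP XP] Xmax] _.
have Xinj x y b c : x \in X -> y \in X -> b \in B -> c \in B ->
    x - b = y - c -> x = y.
  move=> xX yX bB cB /eqP e; apply/eqP.
  by move: (XP x xX) => /forall_inP/(_ y yX)/forall_inP/(_ b bB)/forall_inP
    /(_ c cB)/implyP; apply.
exists X.
  rewrite -cardsX -(@card_in_imset _ _ (fun u : V * V => u.1 - u.2)).
    apply/subset_leq_card/subsetP => _ /imsetP[[x b] /setXP /= [xX bB] ->].
    by apply/imset2P; exists x b => //; apply: (subsetP XS).
  move=> [x b] [y c] /setXP /= [xX bB] /setXP /= [yX cB] e.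
  have exy := Xinj _ _ _ _ xX yX bB cB e.
  by rewrite exy in e *; move/addrI/oppr_inj: e => ->.
move=> s sS; have [sX|sNX] := boolP (s \in X).
  by exists s, b0, b0; split=> //; rewrite addrK.
have: ~~ ok (s |: X).
  by apply/negP => oksX; rewrite -(Xmax _ oksX (subsetUr _ _)) setU11 in sNX.
rewrite /ok subUset sub1set sS XS /=.
case/forall_inPn => x xsX /forall_inPn[y ysX /forall_inPn[b bB]].
case/forall_inPn => c cB; rewrite negb_imply => /andP[/eqP e nxy].
move: xsX ysX; rewrite !in_setU1.
case/orP => [/eqP ex|xX]; case/orP => [/eqP ey|yX].
- by rewrite ex ey eqxx in nxy.
- exists y, b, c; split=> //; rewrite -ex.
  by rewrite -[LHS](subrK b) e addrAC.
- exists x, c, b; split=> //; rewrite -ey.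
  by rewrite -[LHS](subrK c) -e addrAC.
- by rewrite (Xinj _ _ _ _ xX yX bB cB e) eqxx in nxy.
Qed.

Lemma sumsetS (V : finZmodType) (A A' B B' : {set V}) :
  A \subset A' -> B \subset B' -> sumset A B \subset sumset A' B'.
Proof. exact: imset2S. Qed.

Lemma sumsetA (V : finZmodType) (A B C : {set V}) :
  sumset A (sumset B C) = sumset (sumset A B) C.
Proof.
apply/setP => x; apply/imset2P/imset2P.
  case=> a _ aA /imset2P[b c bB cC ->] ->.
  by exists (a + b) c; rewrite ?addrA //; apply: imset2_f.
case=> _ c /imset2P[a b aA bB ->] cC ->.
by exists a (b + c); rewrite ?addrA //; apply: imset2_f.
Qed.

Lemma sumsetC (V : finZmodType) (A B : {set V}) : sumset A B = sumset B A.
Proof.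
by apply/setP => x; apply/imset2P/imset2P => -[a b aA bB ->];
  exists b a; rewrite // addrC.
Qed.

Lemma card_translate (V : finZmodType) (A : {set V}) (c : V) :
  #|[set a + c | a in A]| = #|A|.
Proof. by rewrite card_imset //; apply: addIr. Qed.

(** Petridis's induction on C. Let Z be the set of x in X for which x + B + c already lies in X + B
    + C'. Adding c creates at most #|X + B| - #|Z + B| new elements of X + B + C, and at least #|X|
    - #|Z| new elements of X + C; the minimality of the growth of X, applied to Z, compares the
    two. *)
Lemma petridis (V : finZmodType) (X B C : {set V}) :
  (forall Z : {set V}, Z \subset X ->
     (#|sumset X B| * #|Z| <= #|sumset Z B| * #|X|)%N) ->
  (#|sumset (sumset X B) C| * #|X| <= #|sumset X B| * #|sumset X C|)%N.
Proof.
move=> Xmin.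
have [m] := ubnP #|C|; elim: m C => // m IH C; rewrite ltnS => Cm.
have [->|[c cC]] := set_0Vmem C.
  have -> : sumset (sumset X B) set0 = set0.
    by apply/setP => x; rewrite inE; apply/imset2P => -[a b _]; rewrite inE.
  by rewrite cards0 mul0n.
pose C' := C :\ c.
have C'm : (#|C'| < m)%N by rewrite (leq_trans _ Cm) // (cardsD1 c C) cC.
have {IH}IH := IH C' C'm.
pose Z := [set x in X | [set x + b + c | b in B] \subset sumset (sumset X B)
  C'].
have ZX : Z \subset X by apply/subsetP => x; rewrite inE => /andP[].
pose W := [set x in X | x + c \in sumset X C'].
have WZ : W \subset Z.
  apply/subsetP => x; rewrite !inE => /andP[xX /imset2P[y d yX dC' e]].
  rewrite xX /=; apply/subsetP => _ /imsetP[b bB ->].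
  rewrite -addrA (addrC b) addrA e -addrA (addrC d) addrA.
  by apply: imset2_f => //; apply: imset2_f.
have upper : (#|sumset (sumset X B) C| + #|sumset Z B| <=
    #|sumset (sumset X B) C'| + #|sumset X B|)%N.
  rewrite -(card_translate (sumset Z B) c) -(card_translate (sumset X B) c).
  have sub1 : [set a + c | a in sumset Z B] \subset
      sumset (sumset X B) C' :&: [set a + c | a in sumset X B].
    rewrite subsetI; apply/andP; split; last exact/imsetS/sumsetS.
    apply/subsetP => _ /imsetP[_ /imset2P[x b + bB ->] ->].
    rewrite inE => /andP[xX /subsetP]; apply.
    by apply/imsetP; exists b.
  have sub2 : sumset (sumset X B) C \subset
      sumset (sumset X B) C' :|: [set a + c | a in sumset X B].
    apply/subsetP => _ /imset2P[y d yXB dC ->]; rewrite in_setU.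
    have [->|nd] := eqVneq d c.
      by apply/orP; right; apply/imsetP; exists y.
    by rewrite imset2_f //= in_setD1 nd.
  by rewrite -(cardsUI (sumset _ C')) leq_add ?subset_leq_card.
have lower : (#|sumset X C'| + #|X| <= #|sumset X C| + #|Z|)%N.
  have eW : #|W| = #|sumset X C' :&: [set a + c | a in X]|.
    rewrite -(card_translate W c); apply: eq_card => y; rewrite in_setI.
    apply/imsetP/andP => [[x + ->]|[yS /imsetP[x xX e]]].
      by rewrite inE => /andP[xX ->]; split=> //; apply/imsetP; exists x.
    by exists x => //; rewrite inE xX -e.
  have sub : sumset X C' :|: [set a + c | a in X] \subset sumset X C.
    rewrite subUset; apply/andP; split; first by rewrite sumsetS ?subsetDl.
    by apply/subsetP => _ /imsetP[x xX ->]; apply: imset2_f.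
  rewrite -(card_translate X c) -(cardsUI (sumset _ C')).
  by apply: leq_add; [|rewrite -eW]; apply: subset_leq_card.
have := Xmin Z ZX.
move: upper lower IH; clear; nia.
Qed.

Lemma exists_min_growth (V : finZmodType) (A B : {set V}) : A != set0 ->
  exists2 X : {set V}, X != set0 /\ X \subset A &
    forall Z : {set V}, Z \subset A ->
      (#|sumset X B| * #|Z| <= #|sumset Z B| * #|X|)%N.
Proof.
move=> nA; pose P (X : {set V}) := (X != set0) && (X \subset A).
have PA : P A by rewrite /P nA subxx.
pose r (X : {set V}) : rat := #|sumset X B|%:R / #|X|%:R.
case: (@Order.TotalTheory.arg_minP _ _ _ A P r PA) => X /andP[nX XA] Xmin.
exists X => // Z ZA; have [->|nZ] := eqVneq Z set0.
  by rewrite cards0 muln0.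
have := Xmin Z; rewrite /P nZ ZA => /(_ isT); rewrite /r.
have pos (Y : {set V}) : Y != set0 -> 0 < #|Y|%:R :> rat.
  by rewrite ltr0n card_gt0.
rewrite ler_pdivrMr ?pos // mulrAC ler_pdivlMr ?pos //.
by rewrite -!natrM ler_nat.
Qed.

(** For X of minimal growth, [petridis] gives X + 2B and X + 3B at most K^2 and K^3 times the size
    of X, and the Ruzsa triangle through X multiplies the two bounds. The shape 3B - 2B is the one
    needed to cover 2B - 2B by translates of B - B. *)
Lemma plunnecke_ruzsa32 (V : finZmodType) (A B : {set V}) (K : nat) :
    A != set0 -> (#|sumset A B| <= K * #|A|)%N ->
  (#|diffset (sumset (sumset B B) B) (sumset B B)| <= K ^ 5 * #|A|)%N.
Proof.
move=> nA AB; have [X [nX XA] Xmin] := exists_min_growth B nA.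
have X_gt0 : (0 < #|X|)%N by rewrite card_gt0.
have XB : (#|sumset X B| <= K * #|X|)%N.
  rewrite -(@leq_pmul2r #|A|) ?card_gt0 //.
  apply: leq_trans (Xmin A (subxx A)) _.
  by rewrite (mulnAC K) leq_mul2r AB orbT.
have step C : (#|sumset (sumset X B) C| <= K * #|sumset X C|)%N.
  rewrite -(@leq_pmul2r #|X|) //.
  apply: leq_trans (petridis C _) _.
    by move=> Z ZX; apply: Xmin; apply: subset_trans XA.
  by rewrite mulnAC leq_mul2r XB orbT.
have X2B : (#|sumset X (sumset B B)| <= K ^ 2 * #|X|)%N.
  rewrite sumsetA (leq_trans (step B)) // expnS expn1 -mulnA.
  by rewrite leq_mul2l XB orbT.
have X3B : (#|sumset X (sumset (sumset B B) B)| <= K ^ 3 * #|X|)%N.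
  rewrite -(sumsetA B) sumsetA (leq_trans (step _)) // expnS -mulnA.
  by rewrite leq_mul2l X2B orbT.
apply: (@leq_trans (K ^ 5 * #|X|)); last first.
  by rewrite leq_mul2l subset_leq_card ?orbT.
rewrite -(@leq_pmul2r #|X|) //; apply: leq_trans (ruzsa_triangle _ _ _) _.
rewrite (sumsetC _ X) (leq_trans (leq_mul X3B X2B)) //.
by rewrite mulnACA -expnD mulnA.
Qed.

(** * Energy of dilates and the sum-product phenomenon *)

(** Cauchy-Schwarz against the constant 1, from 2 x y <= x^2 + y^2 summed over all pairs of
    indices. *)
Lemma sum_nat_sqr_le (I : finType) (P : {set I}) (f : I -> nat) :
  ((\sum_(i in P) f i) ^ 2 <= #|P| * \sum_(i in P) f i ^ 2)%N.
Proof.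
rewrite -(@leq_pmul2l 2) // expnS expn1 big_distrlr /= big_distrr /=.
under eq_bigr do rewrite big_distrr /=.
apply: (@leq_trans (\sum_(i in P) \sum_(j in P) (f i ^ 2 + f j ^ 2))%N).
  by apply: leq_sum => i _; apply: leq_sum => j _; rewrite nat_Cauchy.
under eq_bigr do rewrite big_split /= sum_nat_const.
rewrite big_split /= sum_nat_const -big_distrr /=.
by rewrite mul2n -addnn.
Qed.

Lemma card_collisions (aT rT : finType) (f : aT -> rT) (D : {set aT})
    (T : {set rT}) : {in D, forall x, f x \in T} ->
  (#|D| ^ 2 <= #|T| *
     #|[set u : aT * aT | [&& u.1 \in D, u.2 \in D & f u.1 == f u.2]]|)%N.
Proof.
move=> fT; pose c y := #|[set x in D | f x == y]|.
have -> : #|D| = (\sum_(y in T) c y)%N.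
  rewrite -sum1_card (partition_big f (mem T)) //=.
  by apply: eq_bigr => y _; rewrite sum1dep_card.
apply: leq_trans (sum_nat_sqr_le T c) _; rewrite leq_mul2l; apply/orP; right.
rewrite -sum1dep_card (partition_big (fun u => f u.1) (mem T)) /=; last first.
  by move=> u /and3P[uD _ _]; apply: fT.
apply: leq_sum => y _; rewrite sum1dep_card expnS expn1 -cardsX.
apply/subset_leq_card/subsetP => -[u v]; rewrite !inE /=.
by case/andP => /andP[-> /eqP->] /andP[-> /eqP->]; rewrite !eqxx.
Qed.

(** If B + r B has at most E elements, the equation b1 + r b2 = b3 + r b4 has at least #|B|^4 / E
    solutions. Summed over r, the diagonal solutions contribute #|B|^2 for each r, while a
    non-diagonal quadruple determines r = (b3 - b1) / (b2 - b4) and is counted at most once. *)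
Lemma energy_dilates (F : finFieldType) (B S : {set F}) (E : nat) :
    (forall r, r \in S -> (#|sumset B [set r * b | b in B]%R| <= E)%N) ->
  (#|S| * #|B| ^ 4 <= E * (#|B| ^ 4 + #|S| * #|B| ^ 2))%N.
Proof.
move=> SE.
pose Q (r : F) := [set u : (F * F) * (F * F) |
  [&& u.1 \in setX B B, u.2 \in setX B B &
      u.1.1 + r * u.1.2 == u.2.1 + r * u.2.2]].
have lowQ r : r \in S -> (#|B| ^ 4 <= E * #|Q r|)%N.
  move=> rS; have := @card_collisions _ _ (fun u : F * F => u.1 + r * u.2)
    (setX B B) (sumset B [set (r * b) | b in B]).
  rewrite cardsX => H; have -> : (#|B| ^ 4 = (#|B| * #|B|) ^ 2)%N.
    by rewrite expnMn -expnD.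
  apply: leq_trans (H _) _; last by rewrite leq_mul2r SE ?orbT.
  move=> [b c] /setXP /= [bB cB]; apply: imset2_f => //.
  by apply/imsetP; exists c.
pose D := [set u : (F * F) * (F * F) | (u.1 \in setX B B) && (u.1 == u.2)].
have cD : (#|D| <= #|B| ^ 2)%N.
  rewrite expnS expn1 -cardsX.
  apply: leq_trans (leq_imset_card (fun u : F * F => (u, u)) _).
  apply/subset_leq_card/subsetP => -[u v]; rewrite inE /=.
  by case/andP => uB /eqP <-; apply/imsetP; exists u.
pose Q' r := Q r :\: D.
have sumQ' : (\sum_(r in S) #|Q' r| <= #|B| ^ 4)%N.
  have -> : (#|B| ^ 4 = #|setX (setX B B) (setX B B)|)%N.
    by rewrite !cardsX !expnS muln1 !mulnA.
  rewrite -sum1_card.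
  under eq_bigr do rewrite -sum1_card.
  rewrite (exchange_big_dep (mem (setX (setX B B) (setX B B)))) /=; last first.
    by move=> r [u v] _; rewrite !inE /= => /and3P[_ -> /andP[-> _]].
  apply: leq_sum => -[[b1 b2] [b3 b4]] _.
  rewrite sum1dep_card; apply: (@leq_trans #|[set (b3 - b1) / (b2 - b4)]|);
    last by rewrite cards1.
  apply/subset_leq_card/subsetP => r; rewrite !inE /=.
  case/and3P=> _ ne /and3P[/andP[b1B b2B] _ /eqP e].
  have n24 : b2 - b4 != 0.
    apply: contra ne; rewrite subr_eq0 => /eqP e24; rewrite b1B b2B /=.
    by move: e; rewrite e24 => /addIr ->.
  apply/eqP; apply: (mulIf n24); rewrite divfK //.
  by apply/eqP; rewrite -subr_eq0 mulrBr; apply/eqP;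
    rewrite -(subrr (b3 + r * b4)) -{1}e; ring.
have sumQ : (\sum_(r in S) #|Q r| <= #|B| ^ 4 + #|S| * #|B| ^ 2)%N.
  apply: leq_trans (leq_add sumQ' (leqnn _)).
  rewrite -sum_nat_const -big_split /=; apply: leq_sum => r _.
  rewrite -(cardsID D (Q r)) addnC leq_add2l; apply: leq_trans cD.
  exact/subset_leq_card/subsetIr.
apply: leq_trans (_ : \sum_(r in S) E * #|Q r| <= _)%N.
  by rewrite -sum_nat_const; apply: leq_sum => r /lowQ.
by rewrite -big_distrr /= leq_mul2l sumQ orbT.
Qed.

(** Dilation by s preserves B approximately: s B lies in m translates of B - B. When 2B - 2B is
    itself covered by few translates of B - B, such s form an approximate ring, with polynomial
    losses in m. *)
Definition covered (F : finFieldType) (B : {set F}) (m : nat) (s : F) : Prop :=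
  exists2 X : {set F}, (#|X| <= m)%N &
    forall b, b \in B -> exists x b1 b2,
      [/\ x \in X, b1 \in B, b2 \in B & s * b = x + b1 - b2].

Section Covered.

Variables (F : finFieldType) (B Y : {set F}) (k : nat).
Hypothesis Yk : (#|Y| <= k)%N.
Hypothesis coverY : forall b1 b2 b3 b4,
  b1 \in B -> b2 \in B -> b3 \in B -> b4 \in B ->
  exists y c1 c2, [/\ y \in Y, c1 \in B, c2 \in B &
    b1 + b2 - b3 - b4 = y + c1 - c2].

Lemma covered_le (m m' : nat) (s : F) :
  (m <= m')%N -> covered B m s -> covered B m' s.
Proof. by move=> mm' [X Xm XB]; exists X => //; apply: leq_trans mm'. Qed.

Lemma coveredN (m : nat) (s : F) : covered B m s -> covered B m (- s).
Proof.
move=> [X Xm XB]; exists [set - x | x in X].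
  by rewrite (leq_trans (leq_imset_card _ _)).
move=> b /XB[x [b1 [b2 [xX b1B b2B e]]]]; exists (- x), b2, b1.
by split=> //; [apply: imset_f|rewrite mulNr e; ring].
Qed.

Lemma coveredD (m m' : nat) (s s' : F) :
  covered B m s -> covered B m' s' -> covered B (m * m' * k) (s + s').
Proof.
move=> [X Xm XB] [X' Xm' XB']; exists (sumset (sumset X X') Y).
  rewrite (leq_trans (card_imset2_le _ _ _)) // leq_mul //.
  by rewrite (leq_trans (card_imset2_le _ _ _)) // leq_mul.
move=> b bB; have [x [b1 [b2 [xX b1B b2B e]]]] := XB b bB.
have [x' [b1' [b2' [xX' b1B' b2B' e']]]] := XB' b bB.
have [y [c1 [c2 [yY c1B c2B ey]]]] := coverY b1B b1B' b2B b2B'.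
exists (x + x' + y), c1, c2; split=> //; first by do 2!apply: imset2_f => //.
by rewrite mulrDl e e' -!addrA (addrA y) -ey; ring.
Qed.

(** Write s' b = x' + b1 - b2 and apply the covering of s to b1 and to b2. This uses [X'] once, [X]
    twice, and [coverY] to bring 2B - 2B back to B - B. *)
Lemma coveredM (m m' : nat) (s s' : F) :
  covered B m s -> covered B m' s' -> covered B (m' * m ^ 2 * k) (s * s').
Proof.
move=> [X Xm XB] [X' Xm' XB'].
exists (sumset (sumset [set s * x | x in X'] (diffset X X)) Y).
  rewrite (leq_trans (card_imset2_le _ _ _)) // leq_mul //.
  rewrite (leq_trans (card_imset2_le _ _ _)) // leq_mul //.
    by rewrite (leq_trans (leq_imset_card _ _)).
  by rewrite (leq_trans (card_imset2_le _ _ _)) // expnS expn1 leq_mul.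
move=> b bB; have [x' [b1 [b2 [xX' b1B b2B e]]]] := XB' b bB.
have [x1 [c1 [d1 [x1X c1B d1B e1]]]] := XB b1 b1B.
have [x2 [c2 [d2 [x2X c2B d2B e2]]]] := XB b2 b2B.
have [y [a1 [a2 [yY a1B a2B ey]]]] := coverY c1B d2B d1B c2B.
exists (s * x' + (x1 - x2) + y), a1, a2; split=> //.
  apply: imset2_f => //; apply: imset2_f; last exact: imset2_f.
  exact: imset_f.
rewrite -mulrA e mulrBr mulrDr e1 e2 -!addrA (addrA y) -ey; ring.
Qed.

Lemma covered1 : B != set0 -> covered B 1 1.
Proof.
case/set0Pn => b0 b0B; exists [set b0]; first by rewrite cards1.
move=> b bB; exists b0, b, b0; rewrite set11; split=> //; ring.
Qed.

(** Multiplication by d clears the denominator: it sends B + (e / d) B injectively into d B + e B,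
    which lies in X + X' + 2B - 2B. *)
Lemma card_sum_covered (m : nat) (d e : F) :
    covered B m d -> covered B m e -> d != 0 ->
  (#|sumset B [set e / d * b | b in B]%R| <=
     m ^ 2 * #|diffset (sumset B B) (sumset B B)|)%N.
Proof.
move=> [X Xm XB] [X' Xm' XB'] d0.
rewrite -(card_imset _ (mulfI d0)).
apply: (@leq_trans
  #|sumset (sumset X X') (diffset (sumset B B) (sumset B B))|).
  apply/subset_leq_card/subsetP => _ /imsetP[_ /imset2P[b _ bB
    /imsetP[b' bB' ->] ->] ->].
  have [x [b1 [b2 [xX b1B b2B h]]]] := XB b bB.
  have [x' [b1' [b2' [xX' b1B' b2B' h']]]] := XB' b' bB'.
  have -> : d * (b + e / d * b') =
      (x + x') + ((b1 + b1') - (b2 + b2')).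
    rewrite mulrDr mulrA (mulrCA d) divff // mulr1 h h'; ring.
  by do !apply: imset2_f.
rewrite (leq_trans (card_imset2_le _ _ _)) // leq_mul //.
by rewrite (leq_trans (card_imset2_le _ _ _)) // expnS expn1 leq_mul.
Qed.

End Covered.

(** * Sum-product estimate by pivoting on the quotient set *)

Section Pivot.

Variables (F : finFieldType) (B Y : {set F}) (k : nat).
Hypothesis Yk : (#|Y| <= k)%N.
Hypothesis coverY : forall b1 b2 b3 b4,
  b1 \in B -> b2 \in B -> b3 \in B -> b4 \in B ->
  exists y c1 c2, [/\ y \in Y, c1 \in B, c2 \in B &
    b1 + b2 - b3 - b4 = y + c1 - c2].
Hypothesis F_cyclic : forall S : {set F},
  0 \in S -> {in S, forall x, x + 1 \in S} -> S = setT.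
Hypothesis nB : B != set0.
Hypothesis k_gt0 : (0 < k)%N.

(* If the quotient set of [Z] is not all of [F], it is not stable under
   [r |-> r + 1], and a quotient e / d outside it makes [d * z + e * z']
   injective on pairs. *)
Lemma pivot (Z : {set F}) (m : nat) : (0 < m)%N -> (1 < #|Z|)%N ->
    {in Z, forall z, covered B m z} ->
  exists2 S : {set F}, (minn #|F| (#|Z| ^ 2) <= #|S|)%N &
    forall r, r \in S -> exists d e,
      [/\ d != 0, covered B (m ^ 14 * k ^ 11) d,
          covered B (m ^ 14 * k ^ 11) e & r = e / d].
Proof.
move=> m_gt0 /card_gt1P[z0 [z1 [z0Z z1Z nz01]]] ZB.
have ZBN z : z \in Z -> covered B m (- z) by move=> /ZB/coveredN.
have ZBB z z' : z \in Z -> z' \in Z -> covered B (m * m * k) (z - z').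
  by move=> /ZB hz /ZBN; apply: (coveredD Yk coverY hz).
have leM a b : (a <= 14)%N -> (b <= 11)%N ->
    (m ^ a * k ^ b <= m ^ 14 * k ^ 11)%N.
  by move=> ha hb; rewrite leq_mul // leq_pexp2l.
have ZBBM z z' : z \in Z -> z' \in Z -> covered B (m ^ 14 * k ^ 11) (z - z').
  move=> zZ z'Z; apply: covered_le (ZBB _ _ zZ z'Z).
  by rewrite (leq_trans _ (@leM 2 1 _ _)) // expn1 expnS expn1.
pose R := [set r | [exists u : F * F, exists v : F * F,
  [&& u \in setX Z Z, v \in setX Z Z, v.1 != v.2 &
      r == (u.1 - u.2) / (v.1 - v.2)]]].
have RI a b c d : a \in Z -> b \in Z -> c \in Z -> d \in Z -> c != d ->
    (a - b) / (c - d) \in R.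
  move=> aZ bZ cZ dZ ncd; rewrite inE; apply/existsP; exists (a, b).
  by apply/existsP; exists (c, d); rewrite !inE /= aZ bZ cZ dZ ncd eqxx.
have RE r : r \in R -> exists a b c d, [/\ a \in Z, b \in Z,
  c \in Z & d \in Z] /\
    c != d /\ r = (a - b) / (c - d).
  rewrite inE => /existsP[[a b] /existsP[[c d]]]; rewrite !inE /=.
  by case/and4P=> /andP[aZ bZ] /andP[cZ dZ] ncd /eqP e; exists a, b, c, d.
have R0 : 0 \in R by rewrite -(mul0r (z0 - z1)^-1) -(subrr z0) RI.
have [/forall_inP Rcl|] := boolP [forall r in R, r + 1 \in R].
  exists R; first by rewrite (F_cyclic R0 Rcl) cardsT geq_minl.
  move=> r /RE[a [b [c [d [[aZ bZ cZ dZ] [ncd ->]]]]]].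
  by exists (c - d), (a - b); rewrite subr_eq0; split=> //; exact: ZBBM.
case/forall_inPn => r /RE[a [b [c [d [[aZ bZ cZ dZ] [ncd rE]]]]]] r1R.
have ncd0 : c - d != 0 by rewrite subr_eq0.
pose e := (a - b) + (c - d).
have r1E : r + 1 = e / (c - d) by rewrite /e mulrDl divff // rE.
pose f (u : F * F) := (c - d) * u.1 + e * u.2.
have f_inj : {in setX Z Z &, injective f}.
  move=> [s s'] [t t'] /setXP /= [sZ s'Z] /setXP /= [tZ t'Z];
    rewrite /f /= => ef.
  have est' : s' = t'.
    (* A coincidence with s' != t' would exhibit r + 1 = e / (c - d) as a quotient of differences of
       [Z]. *)
    apply/eqP; apply: contraNT r1R => ne.
    have ne' : t' - s' != 0 by rewrite subr_eq0 eq_sym.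
    rewrite r1E (_ : e / (c - d) = (s - t) / (t' - s')) ?RI // 1?eq_sym //.
    apply/eqP; rewrite eqr_div //; apply/eqP.
    have -> : e * (t' - s') = ((c - d) * t + e * t') - (c - d) * t - e * s' by
      ring.
    by rewrite -ef; ring.
  rewrite est' in ef *; congr (_, _).
  by move/addIr: ef; apply: mulfI.
exists [set f u | u in setX Z Z].
  by rewrite card_in_imset // cardsX expnS expn1 geq_minr.
move=> _ /imsetP[[s t] /setXP /= [sZ tZ] ->].
exists 1, (f (s, t)); rewrite divr1 oner_neq0; split=> //.
  by apply: covered_le (covered1 nB); rewrite muln_gt0 !expn_gt0 m_gt0 k_gt0.
(* The origin of the exponents: c - d costs m^2 k and e costs m^4 k^3, so their products with
   elements of [Z] cost m^5 k^3 and m^9 k^7, and the sum costs m^14 k^11. *)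
have ce := coveredD Yk coverY (ZBB _ _ aZ bZ) (ZBB _ _ cZ dZ).
have := coveredD Yk coverY (coveredM Yk coverY (ZBB _ _ cZ dZ) (ZB _ sZ))
  (coveredM Yk coverY ce (ZB _ tZ)).
by apply: covered_le; rewrite leq_eqVlt; apply/orP; left; apply/eqP; ring.
Qed.

Lemma sum_product (Z : {set F}) (m E : nat) : (0 < m)%N -> (1 < #|Z|)%N ->
    {in Z, forall z, covered B m z} ->
    ((m ^ 14 * k ^ 11) ^ 2 * #|diffset (sumset B B) (sumset B B)| <= E)%N ->
  (minn #|F| (#|Z| ^ 2) * #|B| ^ 2 <=
     E * (#|B| ^ 2 + minn #|F| (#|Z| ^ 2)))%N.
Proof.
move=> m_gt0 Z_gt1 ZB ME; have [S cS SB] := pivot m_gt0 Z_gt1 ZB.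
have : (#|S| * #|B| ^ 4 <= E * (#|B| ^ 4 + #|S| * #|B| ^ 2))%N.
  apply: energy_dilates => r /SB[d [e [d0 cd ce ->]]].
  exact: leq_trans (card_sum_covered cd ce d0) ME.
set u := minn _ _ in cS *; set b := #|B|; have b_gt0 : (0 < b)%N by rewrite
  card_gt0.
have -> : (b ^ 4 = b ^ 2 * b ^ 2)%N by rewrite -expnD.
rewrite mulnA -mulnDl mulnA leq_pmul2r ?expn_gt0 ?b_gt0 // => H.
(* Passing from #|S| down to u is safe: the claim is immediate if b^2 <= E, and otherwise it reads
   (b^2 - E) u <= E b^2, which is monotone in u. *)
have [bE|Eb] := leqP (b ^ 2) E; first nia.
nia.
Qed.

End Pivot.

(** * The Balog-Szemeredi-Gowers theorem *)

Lemma sum_card_fibre (aT bT : finType) (G : {set aT * bT}) (A : {set aT})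
    (B : {set bT}) :
  (\sum_(a in A) #|[set b in B | (a, b) \in G]| = #|G :&: setX A B|)%N.
Proof.
rewrite -[RHS]sum1_card (partition_big fst (mem A)) /=; last first.
  by move=> [a b]; rewrite !inE => /and3P[].
apply: eq_bigr => a aA; rewrite sum1dep_card.
rewrite -(card_imset _ (fun x y (e : (a, x) = (a, y)) => congr1 snd e)).
apply: eq_card => -[a' b]; rewrite inE; apply/imsetP/andP => [[b']|].
  by rewrite inE => /andP[b'B abG] [-> ->]; rewrite !inE abG aA b'B eqxx.
case; rewrite !inE => /and3P[abG _ bB] /eqP /= ea.
by exists b; rewrite ?ea // inE bB -ea abG.
Qed.

Lemma sum_card_fibre_sym (aT bT : finType) (G : {set aT * bT}) (A : {set aT})
    (B : {set bT}) :
  (\sum_(b in B) #|[set a in A | (a, b) \in G]| = #|G :&: setX A B|)%N.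
Proof.
rewrite -[RHS]sum1_card (partition_big snd (mem B)) /=; last first.
  by move=> [a b]; rewrite !inE => /and3P[].
apply: eq_bigr => b bB; rewrite sum1dep_card.
rewrite -(card_imset _ (fun x y (e : (x, b) = (y, b)) => congr1 fst e)).
apply: eq_card => -[a b']; rewrite inE; apply/imsetP/andP => [[a']|].
  by rewrite inE => /andP[a'A abG] [-> ->]; rewrite !inE abG bB a'A eqxx.
case; rewrite !inE => /and3P[abG aA _] /eqP /= eb.
by exists a; rewrite ?eb // inE aA -eb abG.
Qed.

Section BSG.

Variables (aT bT : finType) (A : {set aT}) (B : {set bT}) (G : {set aT * bT}).
Variables (n K : nat).
Hypotheses (An : (#|A| <= n)%N) (Bn : (#|B| <= n)%N) (GAB : G \subset setX A B).
Hypotheses (n_gt0 : (0 < n)%N) (K_gt0 : (0 < K)%N).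
Hypothesis dense : (n ^ 2 <= K * #|G|)%N.

Let A0 := [set a in A | (n <= 2 * K * #|[set b in B | (a, b) \in G]|)%N].
Let nbr (b : bT) := [set a in A0 | (a, b) \in G].
Let codeg (a a' : aT) := [set b in B | ((a, b) \in G) && ((a', b) \in G)].
Let bad := [set u : aT * aT | (128 * K ^ 3 * #|codeg u.1 u.2| < n)%N].

Lemma bsg_edges_A0 : (n ^ 2 <= 2 * K * #|G :&: setX A0 B|)%N.
Proof.
have A0A : A0 \subset A by apply/subsetP => a; rewrite inE => /andP[].
pose y := (\sum_(a in A :\: A0) #|[set b in B | (a, b) \in G]|)%N.
have e : (#|G :&: setX A0 B| + y = #|G|)%N.
  rewrite -[in RHS](setIidPl GAB) -(sum_card_fibre G A) (big_setID A0) /=.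
  by rewrite (setIidPr A0A) sum_card_fibre.
suff : (2 * K * y <= n ^ 2)%N.
  move=> H; have : (2 * n ^ 2 <= 2 * K * #|G|)%N by rewrite -mulnA leq_mul2l.
  by rewrite -e mulnDr; move: H; lia.
rewrite big_distrr /=; apply: (@leq_trans (\sum_(a in A :\: A0) n)).
  by apply: leq_sum => a; rewrite !inE negb_and -ltnNge;
    case: (a \in A) => //= /andP[/ltnW].
rewrite sum_nat_const expnS expn1 leq_mul2r (leq_trans _ An) ?orbT //.
exact/subset_leq_card/subsetDl.
Qed.

(* Average over b: large neighbourhoods dominate, while few pairs of vertices
   with a small common neighbourhood lie in the neighbourhood of the same b. *)
Lemma bsg_choice : exists b,
  (n ^ 2 <= 8 * K ^ 2 * #|nbr b| ^ 2)%N /\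
  (16 * K * #|bad :&: setX (nbr b) (nbr b)| <= #|nbr b| ^ 2)%N.
Proof.
have A0A : A0 \subset A by apply/subsetP => a; rewrite inE => /andP[].
(* One inequality carries both conclusions, and it holds on average: summed over b, each term on the
   left is at most n^3, while Cauchy-Schwarz on [bsg_edges_A0] makes the right side at least 2
   n^3. *)
suff [b H] : exists b, (n ^ 2 + 128 * K ^ 3 * #|bad :&: setX (nbr b) (nbr b)| <=
    8 * K ^ 2 * #|nbr b| ^ 2)%N.
  exists b; split; first exact: leq_trans (leq_addr _ _) H.
  rewrite -(@leq_pmul2l (8 * K ^ 2)) ?muln_gt0 ?expn_gt0 ?K_gt0 //.
  apply: leq_trans H; rewrite (leq_trans _ (leq_addl _ _)) // leq_eqVlt.
  by apply/orP; left; apply/eqP; ring.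
have [b bB|none] := pickP [pred b in B | (n ^ 2 + 128 * K ^ 3 *
    #|bad :&: setX (nbr b) (nbr b)| <= 8 * K ^ 2 * #|nbr b| ^ 2)%N].
  by exists b; case/andP: bB.
have cs := sum_nat_sqr_le B (fun b => #|nbr b|).
rewrite sum_card_fibre_sym in cs.
have sbad : (128 * K ^ 3 * \sum_(b in B) #|bad :&: setX (nbr b) (nbr b)| <=
    n ^ 3)%N.
  under eq_bigr do rewrite -sum1_card.
  rewrite (exchange_big_dep (mem (bad :&: setX A A))) /=; last first.
    move=> b [a a'] _; rewrite !inE /= => /and3P[-> /andP[aA0 _]].
    by case/andP=> a'A0 _; move: aA0 a'A0 => /andP[-> _] /andP[-> _].
  rewrite big_distrr /=; apply: (@leq_trans (\sum_(u in setX A A) n)).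
    rewrite big_mkcond [in leqRHS]big_mkcond /=; apply: leq_sum => -[a a'] _.
    rewrite [(a, a') \in _ :&: _]inE; case: ifP => // /andP[badu ->].
    rewrite sum1dep_card; apply: leq_trans (_ : 128 * K ^ 3 * #|codeg a a'| <=
      _)%N.
      rewrite leq_mul2l; apply/orP; right; apply/subset_leq_card/subsetP => b.
      by rewrite !inE /= => /and3P[-> _ /andP[/andP[_ ->] /andP[_ ->]]].
    by move: badu; rewrite inE /= => /ltnW.
  by rewrite sum_nat_const cardsX (expnSr n 2) leq_mul2r (leq_mul An An) orbT.
(* If every b in [B] failed, the sum would give 2 n^3 + #|B| <= 2 n^3. The 1 from the strict
   inequality then makes [B] empty, which contradicts the number of edges. *)
have : (\sum_(b in B) (8 * K ^ 2 * #|nbr b| ^ 2 + 1) <=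
    \sum_(b in B) (n ^ 2 + 128 * K ^ 3 * #|bad :&: setX (nbr b) (nbr b)|))%N.
  apply: leq_sum => b bB; move: (none b).
  by rewrite /= bB /= leqNgt addn1 => /negbFE.
rewrite !big_split /= -!big_distrr /= !sum_nat_const muln1.
have := bsg_edges_A0; move: cs sbad.
set e0 := #|_ :&: _|; set s1 := (\sum_(b in B) _)%N;
  set s2 := (\sum_(b in B) _)%N.
move=> cs s2n e0n le.
have Bn2 : (#|B| * n ^ 2 <= n ^ 3)%N by rewrite (expnS n 2) leq_mul2r Bn orbT.
have e0s : (e0 ^ 2 <= n * s1)%N by rewrite (leq_trans cs) // leq_mul2r Bn orbT.
have n4 : (n ^ 2 * n ^ 2 <= (2 * K * e0) * (2 * K * e0))%N by rewrite leq_mul.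
have : (n * n ^ 3 <= n * (4 * K ^ 2 * s1))%N.
  rewrite -expnS (expnD n 2 2) (leq_trans n4) //.
  rewrite (_ : _ * _ = 4 * K ^ 2 * e0 ^ 2)%N; last by ring.
  by rewrite (mulnCA n) leq_mul2l e0s orbT.
rewrite leq_pmul2l // => n3.
have B0 : #|B| = 0%N by move: n3 le s2n Bn2; lia.
move: cs e0n; rewrite B0 mul0n leqn0 expn_eq0 => /andP[/eqP -> _].
by rewrite muln0 leqn0 expn_eq0 (gtn_eqF n_gt0).
Qed.

(** Inside A1 = [nbr b0], a vertex a of [A'] has at most #|A1| / (8K) bad partners and b in [B'] has
    at least #|A1| / (4K) neighbours. So at least #|A1| / (8K) neighbours of b share n / (128 K^3)
    neighbours with a, each giving a path of length three. As #|A1| >= n / (3K), the constant is 3 *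
    8 * 128 = 3072. *)
Lemma bsg : exists (A' : {set aT}) (B' : {set bT}), [/\ A' \subset A,
  B' \subset B,
  (n <= 6 * K * #|A'|)%N, (n <= 4 * K * #|B'|)%N &
  forall a b, a \in A' -> b \in B' ->
    (n ^ 2 <= 3072 * K ^ 5 * #|[set u : aT * bT |
      [&& (a, u.2) \in G, (u.1, u.2) \in G & (u.1, b) \in G]]|)%N].
Proof.
have [b0 [nA1 badA1]] := bsg_choice; set A1 := nbr b0 in nA1 badA1.
have A1A0 : A1 \subset A0 by apply/subsetP => a; rewrite inE => /andP[].
have A1A : A1 \subset A.
  by apply: subset_trans A1A0 _; apply/subsetP => a; rewrite inE => /andP[].
have nA1' : (n <= 3 * K * #|A1|)%N.
  rewrite -leq_sqr (leq_trans nA1) // !expnMn !leq_mul2r.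
  by rewrite (_ : 8 <= 3 ^ 2)%N ?orbT.
have A1_gt0 : (0 < #|A1|)%N by move: nA1' n_gt0; case: #|A1| => //; lia.
pose bd (a : aT) := [set a' in A1 | (a, a') \in bad].
pose A' := [set a in A1 | (8 * K * #|bd a| <= #|A1|)%N].
pose B' := [set b in B | (#|A1| <= 4 * K * #|[set a in A1 | (a, b) \in G]|)%N].
exists A', B'.
have A'A1 : A' \subset A1 by apply/subsetP => a; rewrite inE => /andP[].
have B'B : B' \subset B by apply/subsetP => b; rewrite inE => /andP[].
have cA' : (#|A1| <= 2 * #|A'|)%N.
  have : (\sum_(a in A1 :\: A') #|A1| <= \sum_(a in A1 :\: A') 8 * K * #|bd
    a|)%N.
    apply: leq_sum => a; rewrite !inE negb_and -ltnNge andbC.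
    by case/andP=> -> /= /ltnW.
  rewrite sum_nat_const -big_distrr /= cardsD (setIidPr A'A1).
  have : (\sum_(a in A1 :\: A') #|bd a| <= #|bad :&: setX A1 A1|)%N.
    rewrite -sum_card_fibre [leqRHS](big_setID A') /= -(setIidPr (subsetDl A1
      A')).
    by rewrite setIC leq_addl.
  move=> s1 s2.
  have : (2 * (#|A1| - #|A'|) * #|A1| <= #|A1| * #|A1|)%N.
    rewrite -mulnA (leq_trans (_ : _ <= 2 * (8 * K * #|bad :&: setX A1 A1|))%N)
      //.
      by rewrite leq_mul2l (leq_trans s2) // leq_mul2l s1 orbT.
    by move: badA1; rewrite expnS expn1; lia.
  by rewrite leq_pmul2r //; have := subset_leq_card A'A1; lia.
split=> //; first exact: subset_trans A1A.
- by rewrite (leq_trans nA1') //; move: cA'; nia.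
- have tot : (#|A1| * n <= 2 * K * #|G :&: setX A1 B|)%N.
    rewrite -sum_card_fibre big_distrr /= -sum_nat_const.
    by apply: leq_sum => a /(subsetP A1A0); rewrite inE => /andP[].
  have : (4 * K * \sum_(b in B :\: B') #|[set a in A1 | (a, b) \in G]|
      <= n * #|A1|)%N.
    rewrite big_distrr /=; apply: (@leq_trans (\sum_(b in B :\: B') #|A1|)%N).
      apply: leq_sum => b; rewrite !inE negb_and -ltnNge andbC.
      by case/andP=> -> /= /ltnW.
    rewrite sum_nat_const leq_mul2r (leq_trans _ Bn) ?orbT //.
    exact/subset_leq_card/subsetDl.
  have : (\sum_(b in B') #|[set a in A1 | (a, b) \in G]| <= #|B'| * #|A1|)%N.
    rewrite -sum_nat_const; apply: leq_sum => b _.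
    by apply/subset_leq_card/subsetP => a; rewrite inE => /andP[].
  move: tot; rewrite -sum_card_fibre_sym (big_setID B') /= (setIidPr B'B).
  set s1 := (\sum_(b in B') _)%N; set s2 := (\sum_(b in _) _)%N => h1 h2 h3.
  rewrite -(@leq_pmul2r #|A1|) //.
  have : (4 * K * s1 <= 4 * K * (#|B'| * #|A1|))%N by rewrite leq_mul2l h2 orbT.
  by rewrite mulnDr in h1; move: h1 h3; lia.
move=> a b; rewrite inE => /andP[aA1 bda]; rewrite inE => /andP[bB degb].
pose S := [set a1 in A1 | (a1, b) \in G] :\: bd a.
have cS : (#|A1| <= 8 * K * #|S|)%N.
  have : (#|[set a1 in A1 | (a1, b) \in G]| <= #|S| + #|bd a|)%N.
    by rewrite -(cardsID (bd a)) addnC leq_add2l subset_leq_card ?subsetIr.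
  move=> h; have : (4 * K * #|[set a1 in A1 | (a1, b) \in G]| <=
     4 * K * (#|S| + #|bd a|))%N by rewrite leq_mul2l h orbT.
  by rewrite mulnDr; move: degb bda; lia.
set P := [set u | _].
have cP : (#|S| * n <= 128 * K ^ 3 * #|P|)%N.
  apply: (@leq_trans (128 * K ^ 3 * \sum_(a1 in S) #|codeg a a1|)).
    rewrite big_distrr -sum_nat_const; apply: leq_sum => a1.
    rewrite in_setD => /andP[+ /setIdP[a1A1 _]].
    by rewrite inE a1A1 /= inE /= -leqNgt.
  rewrite leq_mul2l; apply/orP; right.
  rewrite -[leqRHS]sum1_card.
  pose P0 := [set u : aT * bT | [&& (a, u.2) \in G, (u.1,
    u.2) \in G & u.2 \in B]].
  have -> : (\sum_(a1 in S) #|codeg a a1|)%N = #|P0 :&: setX S B|.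
    rewrite -sum_card_fibre; apply: eq_bigr => a1 _; apply: eq_card => b1.
    by rewrite !inE /=; case: (b1 \in B); rewrite //= ?andbT ?andbF.
  rewrite sum1_card; apply/subset_leq_card/subsetP => -[a1 b1].
  rewrite !inE /= => /andP[/and3P[-> -> _] /andP[/andP[_ /andP[_ ->]] _]].
  by [].
have n_le : (n * n <= 3 * K * (8 * K) * (128 * K ^ 3 * #|P|))%N.
  apply: (@leq_trans (3 * K * (8 * K) * (#|S| * n)))%N;
    last by rewrite leq_mul2l cP orbT.
  have nS : (n <= 3 * K * (8 * K * #|S|))%N.
    by rewrite (leq_trans nA1') // leq_mul2l cS orbT.
  by rewrite (leq_trans (leq_mul nS (leqnn n))) // !mulnA.
rewrite expnS expn1 (leq_trans n_le) // leq_eqVlt; apply/orP; left; apply/eqP;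
  ring.
Qed.

End BSG.

(** A path of length three in the graph of pairs with al a + be b in A writes an element of the
    sumset as an alternating sum of three elements of A. Each element has at least n^2 / (3072 K^5)
    such representations, and only n^3 triples are available. *)
Lemma bsg_sumset (F : finFieldType) (A : {set F}) (al be : F) (n K : nat) :
    (#|A| <= n)%N -> (0 < n)%N -> (0 < K)%N -> al != 0 -> be != 0 ->
    (n ^ 2 <= K * #|[set u in setX A A | al * u.1 + be * u.2 \in A]%R|)%N ->
  exists A' B' : {set F}, [/\ A' \subset A, B' \subset A,
    (n <= 6 * K * #|A'|)%N, (n <= 4 * K * #|B'|)%N &
    (#|(sumset [set al * a | a in A'] [set be * b | b in B'])%R| <=
       3072 * K ^ 5 * n)%N].
Proof.
move=> An n_gt0 K_gt0 al0 be0 dense.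
set G := [set u in setX A A | _] in dense.
have GA : G \subset setX A A by apply/subsetP => u; rewrite inE => /andP[].
have [A' [B' [A'A B'A nA' nB' paths]]] := bsg An An GA n_gt0 K_gt0 dense.
exists A', B'; split=> //.
set D := sumset _ _.
pose P (a b : F) := [set u : F * F |
  [&& (a, u.2) \in G, (u.1, u.2) \in G & (u.1, b) \in G]].
have [-> | D0] := eqVneq #|D| 0%N; first by [].
have /fin_all_exists2[f fAB fE] (d : F) : exists2 u : F * F,
    d \in D -> (u.1 \in A') && (u.2 \in B') &
    d \in D -> d = al * u.1 + be * u.2.
  have [/imset2P[_ _ /imsetP[a aA' ->] /imsetP[b bB' ->] ->]|nd] := boolP (d
    \in D).
    by exists (a, b) => //= _; rewrite aA' bB'.
  by exists (0, 0).
(* d = (al a + be b1) - (al a1 + be b1) + (al a1 + be b) *)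
pose W := [set w : F * (F * F) | (w.1 \in D) && (w.2 \in P (f w.1).1 (f
  w.1).2)].
pose g (w : F * (F * F)) := ((al * (f w.1).1 + be * w.2.2,
  al * w.2.1 + be * w.2.2), al * w.2.1 + be * (f w.1).2).
have g_inj : {in W &, injective g}.
  move=> [d [a1 b1]] [d' [a1' b1']]; rewrite !inE /= => /andP[dD _] /andP[d'D
    _].
  case=> e1 e2 e3; have ed : d = d'.
    rewrite (fE d dD); transitivity ((al * (f d).1 + be * b1) -
      (al * a1 + be * b1) + (al * a1 + be * (f d).2)); first by ring.
    by rewrite e1 e2 e3 [RHS](fE d' d'D); ring.
  rewrite ed in e1 e3 *; move/addrI/(mulfI be0): e1 => ->.
  by move/addIr/(mulfI al0): e3 => ->.
have cW : (#|W| <= n ^ 3)%N.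
  rewrite -(card_in_imset g_inj).
  apply: (@leq_trans #|setX (setX A A) A|); last by rewrite !cardsX !expnSr
    expn0 mul1n !leq_mul.
  apply/subset_leq_card/subsetP => _ /imsetP[[d [a1 b1]] + ->].
  by rewrite !inE /= => /andP[_ /and3P[/andP[_ ->] /andP[_ ->] /andP[_ ->]]].
have lowW : (#|D| * n ^ 2 <= 3072 * K ^ 5 * #|W|)%N.
  have -> : #|W| = (\sum_(d in D) #|P (f d).1 (f d).2|)%N.
    rewrite -sum1_card (partition_big fst (mem D)) /=; last first.
      by move=> [d u]; rewrite inE => /andP[].
    apply: eq_bigr => d dD; rewrite sum1dep_card.
    rewrite -(card_imset _ (fun (x y : F * F) (e : (d, x) = (d,
      y)) => congr1 snd e)).
    apply: eq_card => -[d' u]; rewrite inE; apply/andP/imsetP => [[]|[u' u'P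
      [-> ->]]].
      by rewrite inE /= => /andP[_ uP] /eqP <-; exists u.
    by rewrite inE /= dD u'P eqxx.
  rewrite -sum_nat_const big_distrr /=; apply: leq_sum => d dD.
  by have /andP[aA' bB'] := fAB d dD; apply: paths.
rewrite -(@leq_pmul2r (n ^ 2)) ?expn_gt0 ?n_gt0 // -mulnA -expnS.
by rewrite (leq_trans lowW) // leq_mul2l cW orbT.
Qed.

(** * Many rich dilates *)

(** Cauchy-Schwarz for the number d x of indices j with x in P j: the sum of d^2 counts all pairwise
    intersections, so some i does at least as well as the average. *)
Lemma popular_intersection (I T : finType) (J : {set I}) (P : I -> {set T})
    (W : {set T}) (w c : nat) :
    J != set0 -> (0 < w)%N -> (#|W| <= w)%N ->
    (forall i, i \in J -> P i \subset W /\ (w <= c * #|P i|)%N) ->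
  exists2 i, i \in J & (w * #|J| <= c ^ 2 * \sum_(j in J) #|P j :&: P i|)%N.
Proof.
move=> nJ w_gt0 Ww JP.
pose d (x : T) := #|[set j in J | x \in P j]|.
have sumd : (\sum_(x in W) d x = \sum_(j in J) #|P j|)%N.
  under eq_bigr do rewrite /d -sum1dep_card.
  rewrite (exchange_big_dep (mem J)) /=; last by move=> x j _ /andP[].
  apply: eq_bigr => j jJ; have [PW _] := JP j jJ.
  rewrite sum1dep_card; apply: eq_card => x; rewrite inE jJ.
  case xP: (x \in P j); last by rewrite !andbF.
  by rewrite (subsetP PW x xP).
have sumd2 : (\sum_(x in W) d x ^ 2 =
    \sum_(i in J) \sum_(j in J) #|P j :&: P i|)%N.
  rewrite pair_big_dep /=.
  under [RHS]eq_bigr do rewrite -sum1_card.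
  rewrite (exchange_big_dep (mem W)) /=; last first.
    move=> [i j] x /= /andP[iJ _]; rewrite inE => /andP[_].
    by have [/subsetP PW _] := JP i iJ; apply: PW.
  apply: eq_bigr => x _; rewrite sum1dep_card expnS expn1 -cardsX.
  apply: eq_card => -[i j]; rewrite !inE /=.
  by case: (i \in J); case: (j \in J); rewrite ?andbF //= andbC.
have := sum_nat_sqr_le W d; rewrite sumd sumd2 => cs.
have low : (w * #|J| <= c * \sum_(j in J) #|P j|)%N.
  rewrite mulnC -sum_nat_const big_distrr /=.
  by apply: leq_sum => j /JP[].
have [i /andP[iJ H]|none] := pickP [pred i in J |
    (w * #|J| <= c ^ 2 * \sum_(j in J) #|P j :&: P i|)%N].
  by exists i.
have lt : (c ^ 2 * \sum_(i in J) \sum_(j in J) #|P j :&: P i| <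
    w * #|J| * #|J|)%N.
  rewrite [in ltnRHS]mulnC -sum_nat_const big_distrr /=.
  have [i0 i0J] := set0Pn _ nJ.
  rewrite (bigD1 i0) //= [in ltnRHS](bigD1 i0) //=.
  have lti i : i \in J -> (c ^ 2 * \sum_(j in J) #|P j :&: P i| < w * #|J|)%N.
    by move=> iJ; move: (none i); rewrite /= iJ /= ltnNge => ->.
  rewrite -addSn leq_add ?lti //; apply: leq_sum => i /andP[iJ _].
  exact/ltnW/lti.
have : (w * (w * #|J| * #|J|) <= w * (c ^ 2 *
    \sum_(i in J) \sum_(j in J) #|P j :&: P i|))%N.
  have -> : (w * (w * #|J| * #|J|) = (w * #|J|) ^ 2)%N by ring.
  apply: leq_trans (leq_mul low low) _.
  rewrite (_ : _ * _ = c ^ 2 * (\sum_(j in J) #|P j|) ^ 2)%N; last by ring.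
  rewrite (mulnCA w) leq_mul2l (leq_trans cs) ?orbT //.
  by rewrite leq_mul2r Ww orbT.
by rewrite leq_pmul2l // leqNgt lt.
Qed.

Lemma card_dilate (F : finFieldType) (c : F) (A : {set F}) :
  c != 0 -> #|[set c * a | a in A]| = #|A|.
Proof. by move=> c0; rewrite card_imset //; apply: mulfI. Qed.

(** * Dilates sharing large pieces of a fixed pair of sets *)

Section CommonDilates.

Variables (F : finFieldType) (A0 B0 : {set F}) (z0 : F) (n M : nat).
Hypotheses (z00 : z0 != 0) (n_gt0 : (0 < n)%N) (M_gt0 : (0 < M)%N).
Hypotheses (nA0 : (n <= M * #|A0|)%N) (nB0 : (n <= M * #|B0|)%N).
Hypotheses (A0n : (#|A0| <= n)%N).

Let B := [set z0 * b | b in B0].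

Hypothesis sum0 : (#|sumset A0 B| <= M * n)%N.

Lemma dilates_base_gt0 : B != set0.
Proof.
rewrite -card_gt0 /B card_dilate //; move: nB0 n_gt0.
by case: #|B0| => //; rewrite muln0; lia.
Qed.

Lemma dilates_growth :
  (#|diffset (sumset (sumset B B) B) (sumset B B)| <= M ^ 10 * n)%N.
Proof.
have nA : A0 != set0.
  by rewrite -card_gt0; move: nA0 n_gt0; case: #|A0| => //; rewrite muln0; lia.
have : (#|sumset A0 B| <= M ^ 2 * #|A0|)%N.
  rewrite (leq_trans sum0) // expnS expn1 -mulnA.
  by rewrite leq_mul2l nA0 orbT.
move=> /(plunnecke_ruzsa32 nA) /leq_trans-> //.
by rewrite -expnM leq_mul2l A0n orbT.
Qed.

Lemma dilates_growth22 :
  (#|diffset (sumset B B) (sumset B B)| <= M ^ 10 * n)%N.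
Proof.
have [b0 b0B] := set0Pn _ dilates_base_gt0.
apply: leq_trans dilates_growth; rewrite -(card_translate _ b0).
apply/subset_leq_card/subsetP => _ /imsetP[_ /imset2P[u v uBB vBB ->] ->].
by rewrite addrAC; do 2?apply: imset2_f.
Qed.

(** Ruzsa covering applied to 2B - 2B: the set (2B - 2B) - B is the negative of 3B - 2B, hence has
    at most M^10 n elements, and n <= M #|B| costs one more factor M. *)
Lemma dilates_cover : exists2 Y : {set F}, (#|Y| <= M ^ 11)%N &
  forall b1 b2 b3 b4, b1 \in B -> b2 \in B -> b3 \in B -> b4 \in B ->
  exists y c1 c2, [/\ y \in Y, c1 \in B, c2 \in B &
    b1 + b2 - b3 - b4 = y + c1 - c2].
Proof.
have [Y Yc YP] := ruzsa_covering (diffset (sumset B B) (sumset B B))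
  dilates_base_gt0.
exists Y; last first.
  move=> b1 b2 b3 b4 b1B b2B b3B b4B; apply: YP.
  by rewrite -addrA -opprD; do 2!apply: imset2_f => //.
have B_gt0 : (0 < #|B|)%N by rewrite card_gt0 dilates_base_gt0.
rewrite -(leq_pmul2r B_gt0) (leq_trans Yc) //.
apply: (@leq_trans (M ^ 10 * n)); last first.
  by rewrite (expnSr M 10) -[leqRHS]mulnA leq_mul2l /B card_dilate // nB0 orbT.
apply: leq_trans dilates_growth; rewrite -(card_imset _ oppr_inj).
apply/subset_leq_card/subsetP => _ /imsetP[_ /imset2P[_ b
  /imset2P[u v uBB vBB ->] bB ->] ->].
have -> : - (u - v - b) = (v + b) - u by ring.
by do 2?apply: imset2_f.
Qed.

(** The common pieces P and Q link the two dilates. The triangle through P makes z Q - B small, so z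
    Q is covered by translates of B - B; and B is covered by translates of z0 Q - z0 Q. Multiplying
    the latter by z / z0 lands in z Q - z Q. The cost is 2 M^14 (2 M^7)^2 M^11 = 8 M^39. *)
Lemma dilate_covered (A1 B1 : {set F}) (z : F) : z != 0 ->
    (#|B0| <= n)%N ->
    (#|sumset A1 [set (z * b)%R | b in B1]| <= M * n)%N ->
    (n ^ 2 <= 2 * M ^ 4 * (#|A1 :&: A0| * #|B1 :&: B0|))%N ->
  covered B (8 * M ^ 39) (z / z0).
Proof.
move=> zn0 B0n sum1 nPQ.
set P := A1 :&: A0 in nPQ; set Q := B1 :&: B0 in nPQ.
have Pn : (#|P| <= n)%N by rewrite (leq_trans _ A0n) ?subset_leq_card ?subsetIr.
have Qn : (#|Q| <= n)%N by rewrite (leq_trans _ B0n) ?subset_leq_card ?subsetIr.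
have nP : (n <= 2 * M ^ 4 * #|P|)%N.
  rewrite -(leq_pmul2r n_gt0) mulnn (leq_trans nPQ) // -[leqRHS]mulnA.
  by rewrite !leq_mul2l Qn !orbT.
have nQ : (n <= 2 * M ^ 4 * #|Q|)%N.
  rewrite -(leq_pmul2r n_gt0) mulnn (leq_trans nPQ) // -[leqRHS]mulnA.
  by rewrite (mulnC #|P|) !leq_mul2l Pn !orbT.
have P_gt0 : (0 < #|P|)%N by move: nP n_gt0; case: #|P| => //; rewrite muln0;
  lia.
have Q_gt0 : (0 < #|Q|)%N by move: nQ n_gt0; case: #|Q| => //; rewrite muln0;
  lia.
have B_gt0 : (0 < #|B|)%N by rewrite card_gt0 dilates_base_gt0.
have cB : (n <= M * #|B|)%N by rewrite /B card_dilate.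
pose zQ := [set z * b | b in Q]; pose z0Q := [set z0 * b | b in Q].
have z0QB : z0Q \subset B by apply/imsetS/subsetIr.
have zQB : (#|diffset zQ B| <= 2 * M ^ 6 * n)%N.
  rewrite -(leq_pmul2r P_gt0) (leq_trans (ruzsa_triangle _ _ _)) //.
  rewrite (sumsetC zQ) (leq_trans (leq_mul (_ : _ <= M * n) (_ : _ <= M *
    n)))%N //.
  - apply: leq_trans sum1; apply/subset_leq_card/sumsetS; first exact: subsetIl.
    exact/imsetS/subsetIl.
  - apply: leq_trans sum0; apply/subset_leq_card/sumsetS => //; exact: subsetIr.
  rewrite (_ : M * n * (M * n) = M ^ 2 * n * n)%N; last by ring.
  rewrite (_ : 2 * M ^ 6 * n * #|P| = M ^ 2 * n * (2 * M ^ 4 * #|P|))%N;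
    last by ring.
  by rewrite leq_mul2l nP orbT.
have [X Xc XP] := ruzsa_covering zQ dilates_base_gt0.
have Xle : (#|X| <= 2 * M ^ 7)%N.
  rewrite -(leq_pmul2r B_gt0) (leq_trans Xc) // (leq_trans zQB) //.
  by rewrite (expnSr M 6) mulnA -(mulnA (2 * M ^ 6)%N) leq_mul2l cB orbT.
have nz0Q : z0Q != set0 by rewrite -card_gt0 /z0Q card_dilate.
have [X' Xc' XP'] := ruzsa_covering B nz0Q.
have Xle' : (#|X'| <= 2 * M ^ 14)%N.
  rewrite -(leq_pmul2r Q_gt0) -(card_dilate _ z00) (leq_trans Xc') //.
  apply: (@leq_trans (M ^ 10 * n)); last first.
    rewrite card_dilate // (_ : 2 * M ^ 14 * #|Q| = M ^ 10 * (2 * M ^ 4 *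
      #|Q|))%N.
      by rewrite leq_mul2l nQ orbT.
    by ring.
  apply: leq_trans dilates_growth22; have [b0 b0B] := set0Pn _ dilates_base_gt0.
  apply/subset_leq_card/subsetP => _ /imset2P[b q bB /(subsetP z0QB) qB ->].
  have -> : b - q = (b + b0) - (q + b0) by ring.
  by do 2?apply: imset2_f.
have [Y Yc YP] := dilates_cover.
exists (sumset (sumset [set z / z0 * x | x in X'] (diffset X X)) Y).
  apply: (@leq_trans ((2 * M ^ 14) * ((2 * M ^ 7) * (2 * M ^ 7)) * M ^ 11)).
    rewrite (leq_trans (card_imset2_le _ _ _)) // leq_mul //.
    rewrite (leq_trans (card_imset2_le _ _ _)) // leq_mul //.
      by rewrite (leq_trans (leq_imset_card _ _)).
    by rewrite (leq_trans (card_imset2_le _ _ _)) // leq_mul.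
  by rewrite leq_eqVlt; apply/orP; left; apply/eqP; ring.
move=> b bB; have [x' [_ [_ [x'X' /imsetP[q1 q1Q ->] /imsetP[q2 q2Q ->] ->]]]]
  := XP' b bB.
have [x1 [b1 [b2 [x1X b1B b2B e1]]]] := XP (z * q1) (imset_f _ q1Q).
have [x2 [b3 [b4 [x2X b3B b4B e2]]]] := XP (z * q2) (imset_f _ q2Q).
have [y [c1 [c2 [yY c1B c2B ey]]]] := YP b1 b4 b2 b3 b1B b4B b2B b3B.
exists (z / z0 * x' + (x1 - x2) + y), c1, c2; split=> //.
  by apply: imset2_f => //; apply: imset2_f; [exact: imset_f|exact: imset2_f].
have -> : z / z0 * (x' + z0 * q1 - z0 * q2) = z / z0 * x' + (z * q1 - z * q2).
  by field.
by rewrite e1 e2 -!addrA (addrA y) -ey; ring.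
Qed.

End CommonDilates.

(** The last factor is the E / n of [sum_product] for m = 8 M^39 and k = M^11. The factor 8 K^2 M^8
    is 2 (2 K M^4)^2, where n / (2 K M^4) bounds from below the number of dilations fed into it. *)
Definition dilate_const (K M : nat) : nat :=
  (8 * K ^ 2 * M ^ 8 * (((8 * M ^ 39) ^ 14 * (M ^ 11) ^ 11) ^ 2 * M ^ 10))%N.

(** For each xi, [bsg_sumset] yields large pieces of A with a small sum of dilates, and
    [popular_intersection] picks xi0 whose pieces overlap those of many xi. The corresponding
    quotients of dilation factors form a set Z of about n dilations nearly preserving one B. Then
    [sum_product] bounds #|B|^2 or min(#|F|, #|Z|^2) by a multiple of n, although, up to constants,
    all three are at least n^2. *)
Lemma many_rich_dilates (F : finFieldType) (A Xi : {set F}) (n K : nat) :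
    (forall S : {set F}, 0 \in S -> {in S, forall x,
      x + 1 \in S} -> S = setT) ->
    (0 < n)%N -> (0 < K)%N -> (#|A| <= n)%N -> (n ^ 2 <= K * #|F|)%N ->
    (n <= K * #|Xi|)%N -> 0 \notin Xi -> 1 \notin Xi ->
    (forall xi, xi \in Xi -> (n ^ 2 <= K *
       #|[set u in setX A A | (1 - xi) * u.1 + xi * u.2 \in A]%R|)%N) ->
  (n <= dilate_const K (3072 * K ^ 5))%N.
Proof.
move=> F_cyclic n_gt0 K_gt0 An nF nXi Xi0 Xi1 XiA.
set M := (3072 * K ^ 5)%N.
have M_gt0 : (0 < M)%N by rewrite muln_gt0 expn_gt0 K_gt0.
(* A single M absorbs the three losses 6K, 4K and 3072 K^5 of [bsg_sumset]. *)
have KM : (6 * K <= M)%N.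
  rewrite /M (expnS K 4) mulnA; apply: leq_trans (leq_pmulr _ _).
    by rewrite leq_mul2r orbT.
  by rewrite expn_gt0 K_gt0.
have ME : M = (3072 * K ^ 5)%N by [].
clearbody M.
(* Dividing (1 - xi) a + xi a' by 1 - xi leaves a + zeta a', a sum with a single dilation. *)
pose zeta (xi : F) := xi / (1 - xi).
have zeta_neq0 xi : xi \in Xi -> 1 - xi != 0 /\ zeta xi != 0.
  move=> xiXi; have h1 : 1 - xi != 0.
    by rewrite subr_eq0; apply: contraNneq Xi1 => ->.
  by split=> //; rewrite mulf_neq0 ?invr_eq0 //; apply: contraNneq Xi0 => <-.
have /fin_all_exists2[P PA Psum] (xi : F) : exists2 P : {set F} * {set F},
    xi \in Xi -> [/\ P.1 \subset A, P.2 \subset A, (n <= M * #|P.1|)%N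
      & (n <= M * #|P.2|)%N]
    & xi \in Xi -> (#|sumset P.1 [set (zeta xi * b)%R | b in P.2]| <= M * n)%N.
  have [xiXi|] := boolP (xi \in Xi); last by exists (set0, set0).
  have [h1 h2] := zeta_neq0 xi xiXi.
  have xi0 : xi != 0 by apply: contraNneq Xi0 => <-.
  have [A' [B' [A'A B'A nA' nB' sAB]]] := bsg_sumset An n_gt0 K_gt0 h1 xi0 (XiA
    xi xiXi).
  rewrite -ME in sAB.
  exists (A', B') => /= _.
    split=> //; first by rewrite (leq_trans nA') // leq_mul2r KM orbT.
    by rewrite (leq_trans nB') // leq_mul2r (leq_trans _ KM) ?orbT // leq_mul2r
      orbT.
  apply: leq_trans sAB; rewrite -(card_dilate _ h1);
    apply/subset_leq_card/subsetP.
  move=> _ /imsetP[_ /imset2P[a _ aA' /imsetP[b bB' ->] ->] ->].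
  have -> : (1 - xi) * (a + zeta xi * b) = (1 - xi) * a + xi * b.
    by rewrite /zeta; field.
  by apply: imset2_f; apply: imset_f.
have Xi_gt0 : (0 < #|Xi|)%N by move: nXi; case: #|Xi| => //; rewrite muln0; lia.
have nXi0 : Xi != set0 by rewrite -card_gt0.
pose T (xi : F) := setX (P xi).1 (P xi).2.
have [|||xi0 xi0Xi pop] := @popular_intersection _ _ Xi T (setX A A) (n ^ 2) (M
  ^ 2) nXi0.
- by rewrite expn_gt0 n_gt0.
- by rewrite cardsX expnS expn1 leq_mul.
- move=> xi /PA[P1A P2A nP1 nP2]; split; first exact: setXS.
  by rewrite cardsX -!mulnn mulnACA leq_mul.
pose Z0 := [set xi in Xi | (n ^ 2 <= 2 * M ^ 4 * #|T xi :&: T xi0|)%N].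
have Z0Xi : Z0 \subset Xi by apply/subsetP => xi; rewrite inE => /andP[].
have XiZ0 : (#|Xi| <= 2 * M ^ 4 * #|Z0|)%N.
  rewrite -(@leq_pmul2l (n ^ 2)) ?expn_gt0 ?n_gt0 //.
  pose s1 := (\sum_(xi in Z0) #|T xi :&: T xi0|)%N.
  pose s2 := (\sum_(xi in Xi :\: Z0) #|T xi :&: T xi0|)%N.
  have h0 : (n ^ 2 * #|Xi| <= M ^ 4 * s1 + M ^ 4 * s2)%N.
    rewrite -mulnDr (expnM M 2 2) (leq_trans pop) // (big_setID Z0) /=.
    by rewrite (setIidPr Z0Xi).
  have h1 : (s1 <= #|Z0| * n ^ 2)%N.
    rewrite -sum_nat_const; apply: leq_sum => xi /(subsetP Z0Xi) /PA[P1A P2A _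
      _].
    apply: (@leq_trans #|setX A A|).
      by apply/subset_leq_card/(subset_trans (subsetIl _ _)); apply: setXS.
    by rewrite cardsX expnS expn1 leq_mul.
  have h2 : (2 * M ^ 4 * s2 <= #|Xi| * n ^ 2)%N.
    rewrite big_distrr /=; apply: (@leq_trans (\sum_(xi in Xi :\: Z0) n ^ 2)%N).
      apply: leq_sum => xi; rewrite in_setD inE => /andP[+ xiXi].
      by rewrite xiXi /= -ltnNge => /ltnW.
    by rewrite sum_nat_const leq_mul2r subset_leq_card ?subsetDl ?orbT.
  have h3 : (2 * M ^ 4 * s1 <= 2 * M ^ 4 * (#|Z0| * n ^ 2))%N.
    by rewrite leq_mul2l h1 orbT.
  by move: s1 s2 h0 h2 h3 {h1}; move: #|Z0| #|Xi| => z x s1 s2; lia.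
have [P01A P02A nP01 nP02] := PA xi0 xi0Xi.
have [_ z00] := zeta_neq0 xi0 xi0Xi.
set B := [set zeta xi0 * b | b in (P xi0).2].
have P01n : (#|(P xi0).1| <= n)%N by rewrite (leq_trans _ An) ?subset_leq_card.
have P02n : (#|(P xi0).2| <= n)%N by rewrite (leq_trans _ An) ?subset_leq_card.
have nB := dilates_base_gt0 z00 n_gt0 M_gt0 nP01 nP02 P01n (Psum xi0 xi0Xi).
have cB : (n <= M * #|B|)%N by rewrite card_dilate.
have [Y Yc YP] := dilates_cover z00 n_gt0 M_gt0 nP01 nP02 P01n (Psum xi0 xi0Xi).
have g22 := dilates_growth22 z00 n_gt0 M_gt0 nP01 nP02 P01n (Psum xi0 xi0Xi).
pose Z := [set zeta xi / zeta xi0 | xi in Z0].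
have cZ : #|Z| = #|Z0|.
  apply: card_in_imset => x y /(subsetP Z0Xi) xXi /(subsetP Z0Xi) yXi.
  have [hx _] := zeta_neq0 x xXi; have [hy _] := zeta_neq0 y yXi.
  move=> /(mulIf (invr_neq0 z00)) /eqP; rewrite /zeta eqr_div // => /eqP e.
  by rewrite -[x](subrK (x * y)) -{1}[x]mulr1 -mulrBr e; ring.
set c := (((8 * M ^ 39) ^ 14 * (M ^ 11) ^ 11) ^ 2 * M ^ 10)%N.
have c_gt0 : (0 < c)%N by rewrite !(muln_gt0, expn_gt0) M_gt0.
rewrite /dilate_const -/c.
have cdef : c = (((8 * M ^ 39) ^ 14 * (M ^ 11) ^ 11) ^ 2 * M ^ 10)%N by [].
clearbody c.
have K_le : (K <= K ^ 2)%N by rewrite -mulnn leq_pmulr.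
have [Z1|Z_gt1] := leqP #|Z| 1.
  have XiM : (#|Xi| <= 2 * M ^ 4 * 1)%N.
    by rewrite (leq_trans XiZ0) // leq_mul2l -cZ Z1 orbT.
  apply: leq_trans nXi (leq_trans (leq_mul K_le XiM) _).
  rewrite muln1 mulnA (mulnC (K ^ 2)%N) -[leqLHS]muln1.
  apply: leq_mul c_gt0; apply: leq_mul; last by rewrite leq_pexp2l.
  by rewrite leq_mul2r orbT.
have ZB : {in Z, forall z, covered B (8 * M ^ 39) z}.
  move=> _ /imsetP[xi + ->]; rewrite inE => /andP[xiXi popxi].
  have [_ zn0] := zeta_neq0 xi xiXi; have [P1A P2A _ _] := PA xi xiXi.
  apply: (dilate_covered z00 n_gt0 M_gt0 nP01 nP02 P01n (Psum xi0 xi0Xi) zn0 _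
    (Psum xi xiXi)) => //.
  apply: leq_trans popxi _; rewrite leq_mul2l; apply/orP; right.
  rewrite -cardsX; apply/subset_leq_card/subsetP => -[a b].
  by rewrite !inE /= => /andP[/andP[-> ->] /andP[-> ->]].
have m_gt0 : (0 < 8 * M ^ 39)%N by rewrite muln_gt0 expn_gt0 M_gt0.
have k_gt0 : (0 < M ^ 11)%N by rewrite expn_gt0 M_gt0.
have cE : (((8 * M ^ 39) ^ 14 * (M ^ 11) ^ 11) ^ 2 *
    #|diffset (sumset B B) (sumset B B)| <= c * n)%N.
  by rewrite cdef -[leqRHS]mulnA leq_mul2l g22 orbT.
have := sum_product Yc YP F_cyclic nB k_gt0 m_gt0 Z_gt1 ZB cE.
set w := minn _ _ => sp.
have nw : (n ^ 2 <= 4 * K ^ 2 * M ^ 8 * w)%N.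
  rewrite /w; case: (leqP #|F| (#|Z| ^ 2)) => _.
    apply: leq_trans nF _; rewrite leq_mul2r; apply/orP; right.
    rewrite (leq_trans K_le) // mulnAC leq_pmull // muln_gt0 expn_gt0 M_gt0.
    by [].
  have : (n <= K * (2 * M ^ 4 * #|Z|))%N.
    by rewrite (leq_trans nXi) // leq_mul2l cZ XiZ0 orbT.
  rewrite -leq_sqr => /leq_trans-> //.
  by rewrite leq_eqVlt; apply/orP; left; apply/eqP; ring.
rewrite -(leq_pmul2r n_gt0) mulnn.
(* Either #|B|^2 is small, which suffices because n <= M #|B|, or the term c n w takes at most half
   of w #|B|^2 and w <= 2 c n remains. *)
have [bE|Eb] := leqP (#|B| ^ 2) (2 * (c * n)).
  apply: (@leq_trans ((M * #|B|) ^ 2)); first by rewrite leq_sqr.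
  apply: (@leq_trans (M ^ 2 * (2 * (c * n)))).
    by rewrite expnMn leq_mul2l bE orbT.
  rewrite mulnA -[leqRHS]mulnA leq_mul2r; apply/orP; right.
  rewrite mulnC; apply: leq_mul; last by rewrite leq_pexp2l.
  by apply: (@leq_trans 8) => //; rewrite leq_pmulr // expn_gt0 K_gt0.
have B2_gt0 : (0 < #|B| ^ 2)%N by rewrite expn_gt0 card_gt0 nB.
have wc : (w <= 2 * (c * n))%N.
  rewrite -(leq_pmul2r B2_gt0).
  have : (2 * (c * n) * w <= #|B| ^ 2 * w)%N by rewrite leq_mul2r (ltnW Eb)
    orbT.
  by move: sp {nw Eb}; move: (#|B| ^ 2)%N w (c * n)%N; clear; lia.
rewrite (leq_trans nw) // (leq_trans (leq_mul (leqnn _) wc)) //.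
by rewrite leq_eqVlt; apply/orP; left; apply/eqP; ring.
Qed.

(** * Products of three involutions *)

Lemma quadratic_three_roots (F : fieldType) (c2 c1 c0 x1 x2 x3 : F) :
    x1 != x2 -> x2 != x3 -> x3 != x1 ->
    c2 * x1 ^+ 2 + c1 * x1 + c0 = 0 -> c2 * x2 ^+ 2 + c1 * x2 + c0 = 0 ->
    c2 * x3 ^+ 2 + c1 * x3 + c0 = 0 ->
  [/\ c2 = 0, c1 = 0 & c0 = 0].
Proof.
rewrite -subr_eq0 -(subr_eq0 x2) -(subr_eq0 x3) => n12 n23 n31 h1 h2 h3.
have e12 : c2 * (x1 + x2) + c1 = 0.
  apply: (mulfI n12); rewrite mulr0 -[RHS](subrr 0) -{1}h1 -h2; ring.
have e23 : c2 * (x2 + x3) + c1 = 0.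
  apply: (mulfI n23); rewrite mulr0 -[RHS](subrr 0) -{1}h2 -h3; ring.
have c20 : c2 = 0.
  apply: (mulfI n31); rewrite mulr0 -[RHS](subrr 0) -{1}e23 -e12; ring.
have c10 : c1 = 0 by rewrite -e12 c20; ring.
by split=> //; rewrite -h1 c20 c10; ring.
Qed.

Section MoebiusWords.

Variables (F : fieldType) (mu : F).
Hypotheses (mu_neq0 : mu != 0) (lam_neq0 : 1 + mu != 0).

(* The involution exchanging [b] and infinity; the junk value at [x = b] is
  [b]. *)
Definition swap (b x : F) : F := b + (1 + mu) * b ^+ 2 / (x - b).

(** The division-free graph of [swap], symmetric in x and y. For b != 0 it excludes x = b, where
    [swap] takes its junk value. *)
Definition swapped (b x y : F) : bool := (x - b) * (y - b) == (1 + mu) * b ^+ 2.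

Lemma swappedC (b x y : F) : swapped b x y = swapped b y x.
Proof. by rewrite /swapped mulrC. Qed.

Lemma swapped_neq (b x y : F) : b != 0 -> swapped b x y -> x - b != 0.
Proof.
move=> b0 /eqP e; apply: contraTneq (mulf_neq0 lam_neq0 (expf_neq0 2 b0)).
by move=> xb; rewrite -e xb mul0r eqxx.
Qed.

Lemma swappedE (b x y : F) : b != 0 -> swapped b x y -> y = swap b x.
Proof.
move=> b0 sw; have xb := swapped_neq b0 sw; move/eqP: sw => e.
by rewrite /swap -e; field.
Qed.

Lemma swappedM (b x y : F) : swapped b x y ->
  b * x + mu * b ^+ 2 = y * (x - b).
Proof. by move/eqP => e; rewrite -[LHS](subrK ((x - b) * (y - b))) {1}e;
  ring. Qed.

(* [[b1 * wP, mu b1 b3 * wQ], [wR, b3 * wS]] is the product of the matrices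
   [[b, mu b^2], [1, - b]] of the swaps at b1, b2 and b3. *)
Definition wP (w : F * F * F) : F := let: (b1, b2, b3) := w in
  b2 * b3 + mu * b1 * b3 + mu * b2 ^+ 2 - mu * b1 * b2.
Definition wQ (w : F * F * F) : F := let: (b1, b2, b3) := w in
  b2 * b3 + mu * b1 * b3 - b2 ^+ 2 + b1 * b2.
Definition wR (w : F * F * F) : F := let: (b1, b2, b3) := w in
  b2 * b3 - b1 * b3 + mu * b2 ^+ 2 + b1 * b2.
Definition wS (w : F * F * F) : F := let: (b1, b2, b3) := w in
  mu * b2 * b3 - mu * b1 * b3 - mu * b2 ^+ 2 - b1 * b2.

Definition wnum (w : F * F * F) (x : F) : F :=
  w.1.1 * wP w * x + mu * w.1.1 * w.2 * wQ w.
Definition wden (w : F * F * F) (x : F) : F := wR w * x + w.2 * wS w.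

Definition wprod (w : F * F * F) : F := w.1.1 * w.1.2 * w.2.

(** Each swap matrix has determinant - (1 + mu) b^2, and determinants multiply. *)
Lemma wdet (w : F * F * F) :
  (w.1.1 * wP w) * (w.2 * wS w) - (mu * w.1.1 * w.2 * wQ w) * wR w =
  - ((1 + mu) ^+ 3 * wprod w ^+ 2).
Proof. by case: w => -[b1 b2] b3; rewrite /wprod /=; ring. Qed.

Lemma word_action (b1 b2 b3 x y1 y2 z : F) :
    b1 != 0 -> b2 != 0 -> b3 != 0 ->
    swapped b3 x y1 -> swapped b2 y1 y2 -> swapped b1 y2 z ->
  wden (b1, b2, b3) x != 0 /\
  wnum (b1, b2, b3) x = wden (b1, b2, b3) x * z.
Proof.
move=> b10 b20 b30 s1 s2 s3.
have n1 := swapped_neq b30 s1; have n2 := swapped_neq b20 s2.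
have n3 := swapped_neq b10 s3.
have := swappedM s1; have := swappedM s2; have := swappedM s3 => e3 e2 e1.
(* The denominator of the composite map is the product of the three successive denominators, none of
   which vanishes. *)
have dE : wden (b1, b2, b3) x = (x - b3) * (y1 - b2) * (y2 - b1).
  transitivity ((b2 - b1) * (b3 * x + mu * b3 ^+ 2) +
    b2 * (mu * b2 + b1) * (x - b3)); first by rewrite /wden /=; ring.
  rewrite e1; transitivity ((x - b3) *
    ((b2 * y1 + mu * b2 ^+ 2) - b1 * (y1 - b2))); first by ring.
  by rewrite e2; ring.
split; first by rewrite dE !mulf_neq0.
rewrite dE; transitivity (b1 * (b2 + mu * b1) * (b3 * x + mu * b3 ^+ 2) +
    mu * b1 * b2 * (b2 - b1) * (x - b3)); first by rewrite /wnum /=; ring.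
rewrite e1; transitivity ((x - b3) *
    (b1 * (b2 * y1 + mu * b2 ^+ 2) + mu * b1 ^+ 2 * (y1 - b2))); first by ring.
rewrite e2; transitivity ((x - b3) * (y1 - b2) * (b1 * y2 + mu * b1 ^+ 2)).
  by ring.
by rewrite e3; ring.
Qed.

(* Excludes the words whose product degenerates to a single swap or to a
   dilation, the fibres of which are large. *)
Definition generic (w : F * F * F) : bool :=
  [&& wprod w != 0, w.1.1 != w.1.2, w.1.2 != w.2 & w.1.1 * w.2 != w.1.2 ^+ 2].

Lemma moebius_sub (w : F * F * F) (x x' z z' : F) :
    wnum w x = wden w x * z -> wnum w x' = wden w x' * z' ->
  wden w x * wden w x' * (z - z') =
    - ((1 + mu) ^+ 3 * wprod w ^+ 2) * (x - x').
Proof.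
move=> e e'; transitivity (wnum w x * wden w x' - wnum w x' * wden w x).
  by rewrite e e'; ring.
by rewrite -wdet /wnum /wden; ring.
Qed.

(* After division by [wprod w] all the matrices have the same determinant, so
   two of them inducing the same Moebius map differ by a sign. *)
Lemma same_moebius (w w' : F * F * F) (x1 x2 x3 z1 z2 z3 : F) :
    wprod w' != 0 -> x1 != x2 -> x2 != x3 -> x3 != x1 ->
    wnum w x1 = wden w x1 * z1 -> wnum w x2 = wden w x2 * z2 ->
    wnum w x3 = wden w x3 * z3 ->
    wnum w' x1 = wden w' x1 * z1 -> wnum w' x2 = wden w' x2 * z2 ->
    wnum w' x3 = wden w' x3 * z3 ->
  exists2 e : F, e \in [:: 1; -1] &
    [/\ wprod w' * (w.1.1 * wP w) = e * wprod w * (w'.1.1 * wP w'),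
        wprod w' * (mu * w.1.1 * w.2 * wQ w) =
          e * wprod w * (mu * w'.1.1 * w'.2 * wQ w'),
        wprod w' * wR w = e * wprod w * wR w' &
        wprod w' * (w.2 * wS w) = e * wprod w * (w'.2 * wS w')].
Proof.
move=> D'0 n12 n23 n31 h1 h2 h3 h1' h2' h3'.
have := wdet w; have := wdet w'; move: h1 h2 h3 h1' h2' h3';
  rewrite /wnum /wden.
set p := w.1.1 * _; set q := mu * _ * _ * _; set r := wR w; set s := _ * wS w.
set p' := w'.1.1 * _; set q' := mu * _ * _ * _; set r' := wR w'.
set s' := _ * wS w'; move: p q r s p' q' r' s' => p q r s p' q' r' s'.
set D := wprod w; set D' := wprod w' in D'0 *.
move=> h1 h2 h3 h1' h2' h3' det' det.
have quad x z : p * x + q = (r * x + s) * z -> p' * x + q' = (r' * x + s') * z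
  ->
    (p * r' - p' * r) * x ^+ 2 + (p * s' + q * r' - p' * s - q' * r) * x +
      (q * s' - q' * s) = 0.
  move=> h h'; transitivity ((p * x + q) * (r' * x + s') -
    (p' * x + q') * (r * x + s)); first by ring.
  by rewrite h h'; ring.
have [c2 c1 c0] := quadratic_three_roots n12 n23 n31 (quad _ _ h1 h1')
  (quad _ _ h2 h2') (quad _ _ h3 h3').
(* With M = [[p, q], [r, s]] and M' likewise, the three vanishing coefficients say that adj(M') M is
   the scalar matrix [sg]. Hence det(M') M = sg M', and taking determinants gives sg^2 = det(M)
   det(M'). *)
pose sg := s' * p - q' * r.
have sgE : sg = p' * s - r' * q.
  by apply/eqP; rewrite -subr_eq0; apply/eqP; rewrite -c1 /sg; ring.
have ep : (p' * s' - q' * r') * p = sg * p'.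
  by apply/eqP; rewrite -subr_eq0; apply/eqP;
     rewrite /sg -[RHS](mulr0 (- q')) -c2; ring.
have eq : (p' * s' - q' * r') * q = sg * q'.
  by apply/eqP; rewrite -subr_eq0; apply/eqP;
     rewrite sgE -[RHS](mulr0 p') -c0; ring.
have er : (p' * s' - q' * r') * r = sg * r'.
  by apply/eqP; rewrite -subr_eq0; apply/eqP;
     rewrite /sg -[RHS](mulr0 (- s')) -c2; ring.
have es : (p' * s' - q' * r') * s = sg * s'.
  by apply/eqP; rewrite -subr_eq0; apply/eqP;
     rewrite sgE -[RHS](mulr0 r') -c0; ring.
have sg2 : sg ^+ 2 = ((1 + mu) ^+ 3 * D * D') ^+ 2.
  transitivity ((p * s - q * r) * (p' * s' - q' * r'));
    last by rewrite det det'; ring.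
  rewrite expr2 {1}/sg sgE; apply/eqP; rewrite -subr_eq0; apply/eqP.
  rewrite (_ : _ - _ = - (p * r' - p' * r) * (q * s' - q' * s)); last by ring.
  by rewrite c0 mulr0.
have l30 : (1 + mu) ^+ 3 * D' != 0 by rewrite mulf_neq0 ?expf_neq0.
have fin (e a a' : F) : sg = e * ((1 + mu) ^+ 3 * D * D') ->
    (p' * s' - q' * r') * a = sg * a' -> D' * a = - e * D * a'.
  move=> sgv; rewrite det' sgv => h; apply: (mulfI l30).
  by apply: oppr_inj; rewrite -[LHS]/(- _) (_ : - _ = - ((1 + mu) ^+ 3 * D' ^+
    2) * a); [rewrite h|]; ring.
move/eqP: sg2; rewrite eqf_sqr => /orP[] /eqP sgv.
  exists (-1); first by rewrite !inE eqxx orbT.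
  by split; apply: fin; rewrite // mul1r.
exists 1; first by rewrite !inE eqxx.
by split; rewrite -[1]opprK; apply: fin; rewrite // mulN1r.
Qed.

End MoebiusWords.

Section GenericFibre.

Variables (F : finFieldType) (mu : F).
Hypotheses (mu_neq0 : mu != 0) (lam_neq0 : 1 + mu != 0).

(* The equations for [wP] and [wS] give b1 = k * b3, after which the first one
   becomes a quadratic equation for b3 / b2. *)
Lemma card_generic_class (W : {set F * F * F}) (al be ka ro : F) :
    (forall w, w \in W -> [/\ generic w, wP mu w = al * (w.1.2 * w.2),
       wS mu w = be * (w.1.1 * w.1.2), mu * wQ mu w = ka * w.1.2 &
       wR mu w = ro * wprod w]) ->
  (#|W| <= 2)%N.
Proof.
move=> WP.
have nz b1 b2 b3 : (b1, b2, b3) \in W ->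
    [/\ [/\ b1 != 0, b2 != 0 & b3 != 0], b1 != b2, b2 != b3 &
        b1 * b3 != b2 ^+ 2].
  move=> /WP[/and4P[/= h1 h2 h3 h4] _ _ _ _]; split=> //.
  by move: h1; rewrite /wprod /= !mulf_eq0 !negb_or => /andP[/andP[]].
(* The quadratic terms cancel in wP + wS = (1 + mu) b2 (b3 - b1), which leaves a linear relation
   between b1 and b3. *)
have lin b1 b2 b3 : (b1, b2, b3) \in W ->
    (1 + mu + be) * b1 = (1 + mu - al) * b3.
  move=> bW; have [[b10 b20 b30] _ _ _] := nz _ _ _ bW.
  have [_ /= eP eS _ _] := WP _ bW; apply: (mulfI b20).
  apply/eqP; rewrite -subr_eq0; apply/eqP.
  transitivity (be * (b1 * b2) + al * (b2 * b3) - (1 + mu) * b2 * (b3 - b1)).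
    by ring.
  by rewrite -eP -eS; ring.
have coef b1 b2 b3 : (b1, b2, b3) \in W -> 1 + mu - al != 0 /\ 1 + mu + be != 0.
  move=> bW; have [[b10 b20 b30] n12 n23 _] := nz _ _ _ bW.
  have l := lin _ _ _ bW; have [_ /= eP _ _ _] := WP _ bW.
  have al0 : 1 + mu - al != 0.
    apply/eqP => al0; have : mu * ((b1 - b2) * (b3 - b2)) = 0.
      transitivity (al * (b2 * b3) - (1 + mu) * b2 * b3); first by rewrite -eP;
        ring.
      by rewrite -[RHS](mul0r (- (b2 * b3))) -al0; ring.
    apply/eqP; rewrite !mulf_neq0 ?subr_eq0 //; by rewrite eq_sym.
  split=> //; apply: contraNneq (mulf_neq0 al0 b30) => be0.
  by rewrite -l be0 mul0r.
pose k := (1 + mu - al) / (1 + mu + be).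
have b1E b1 b2 b3 : (b1, b2, b3) \in W -> b1 = k * b3.
  move=> bW; have [al0 be0] := coef _ _ _ bW; apply: (mulfI be0).
  by rewrite (lin _ _ _ bW) /k; field.
have root w : w \in W -> (mu * k) * (w.2 / w.1.2) ^+ 2 +
    (1 - mu * k - al) * (w.2 / w.1.2) + mu = 0.
  case: w => -[b1 b2] b3 bW; have [[b10 b20 b30] _ _ _] := nz _ _ _ bW.
  have [_ /= eP _ _ _] := WP _ bW; have e := b1E _ _ _ bW.
  apply: (mulIf (expf_neq0 2 b20)); rewrite mul0r /=.
  transitivity (wP mu (b1, b2, b3) - al * (b2 * b3));
    last by rewrite /= eP subrr.
  by rewrite /= e; field.
(* For a given z = b3 / b2 the word is b2 times (k z, 1, z), so only the scale b2 is left. It is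
   read off the equation for wQ if Q1 != 0 and otherwise off the one for wR; both fail only if Q1 =
   R1 = 0, and then b1 b3 = b2^2 because Q1 - R1 = (1 + mu) (k z^2 - 1). *)
have zinj : {in W &, injective (fun w : F * F * F => w.2 / w.1.2)}.
  case=> -[b1 b2] b3 [[c1 c2] c3] bW cW /= ez.
  have [[b10 b20 b30] _ _ nb] := nz _ _ _ bW.
  have [[c10 c20 c30] _ _ nc] := nz _ _ _ cW.
  pose z := b3 / b2.
  have eb3 : b3 = z * b2 by rewrite /z divfK.
  have ec3 : c3 = z * c2 by rewrite /z ez divfK.
  have eb1 : b1 = k * (z * b2) by rewrite -eb3; apply: b1E bW.
  have ec1 : c1 = k * (z * c2) by rewrite -ec3; apply: b1E cW.
  have [_ /= _ _ bQ bR] := WP _ bW; have [_ /= _ _ cQ cR] := WP _ cW.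
  suff e2 : b2 = c2 by rewrite eb1 ec1 eb3 ec3 e2.
  pose Q1 := z + mu * k * z ^+ 2 - 1 + k * z.
  pose R1 := z - k * z ^+ 2 + mu + k * z.
  have bQ1 : mu * b2 * Q1 = ka.
    apply: (mulIf b20); rewrite -bQ eb1 eb3 /Q1; ring.
  have cQ1 : mu * c2 * Q1 = ka.
    apply: (mulIf c20); rewrite -cQ ec1 ec3 /Q1; ring.
  have [Q10|Q1n0] := eqVneq Q1 0; last first.
    by apply: (mulfI mu_neq0); apply: (mulIf Q1n0); rewrite bQ1 cQ1.
  have bR1 : R1 = ro * (k * z ^+ 2) * b2.
    apply: (mulIf (expf_neq0 2 b20)); transitivity (ro * wprod (b1, b2, b3)).
      by rewrite -bR eb1 eb3 /R1; ring.
    by rewrite /wprod /= eb1 eb3; ring.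
  have cR1 : R1 = ro * (k * z ^+ 2) * c2.
    apply: (mulIf (expf_neq0 2 c20)); transitivity (ro * wprod (c1, c2, c3)).
      by rewrite -cR ec1 ec3 /R1; ring.
    by rewrite /wprod /= ec1 ec3; ring.
  have R1n0 : R1 != 0.
    apply: contraNneq nb => R10; rewrite -subr_eq0; apply/eqP.
    apply: (mulfI lam_neq0); rewrite mulr0.
    transitivity ((Q1 - R1) * b2 ^+ 2); last by rewrite Q10 R10; ring.
    by rewrite eb1 eb3 /Q1 /R1; ring.
  have ro0 : ro * (k * z ^+ 2) != 0.
    by apply: contraNneq R1n0 => ro0; rewrite bR1 ro0 mul0r.
  by apply: (mulfI ro0); rewrite -bR1 -cR1.
rewrite -(card_in_imset zinj) leqNgt; apply/negP => /card_gt2P.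
move=> [x [y [z [[/imsetP[w1 w1W ->] /imsetP[w2 w2W ->] /imsetP[w3 w3W ->]]]]]].
move=> [n12 n23 n31].
(* The quadratic cannot vanish identically, as its constant coefficient is mu. *)
have [_ _ mu0] := quadratic_three_roots n12 n23 n31 (root _ w1W) (root _ w2W)
  (root _ w3W).
by move: mu_neq0; rewrite mu0 eqxx.
Qed.

(** Three values determine a Moebius map, hence the matrix divided by [wprod] up to sign. Each of
    the two signs fixes the normalised entries, and [card_generic_class] allows two words for these:
    2 * 2 = 4. *)
Lemma card_generic_fibre (W : {set F * F * F}) (x1 x2 x3 z1 z2 z3 : F) :
    x1 != x2 -> x2 != x3 -> x3 != x1 ->
    (forall w, w \in W -> [/\ generic w, wnum mu w x1 = wden mu w x1 * z1,
       wnum mu w x2 = wden mu w x2 * z2 & wnum mu w x3 = wden mu w x3 * z3]) ->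
  (#|W| <= 4)%N.
Proof.
move=> n12 n23 n31 WP; have [->|[w0 w0W]] := set_0Vmem W;
  first by rewrite cards0.
have [g0 h1 h2 h3] := WP w0 w0W.
pose D := wprod w0; have D0 : D != 0 by case/and4P: g0.
pose C (e : F) := [set w in W | [&& D * (w.1.1 * wP mu w) ==
    e * wprod w * (w0.1.1 * wP mu w0),
  D * (mu * w.1.1 * w.2 * wQ mu w) ==
    e * wprod w * (mu * w0.1.1 * w0.2 * wQ mu w0),
  D * wR mu w == e * wprod w * wR mu w0 &
  D * (w.2 * wS mu w) == e * wprod w * (w0.2 * wS mu w0)]].
have C2 e : (#|C e| <= 2)%N.
  apply: (@card_generic_class _ (e * (w0.1.1 * wP mu w0) / D)
    (e * (w0.2 * wS mu w0) / D) (e * (mu * w0.1.1 * w0.2 * wQ mu w0) / D)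
    (e * wR mu w0 / D)) => w; rewrite inE => /andP[wW].
  case/and4P=> /eqP eP /eqP eQ /eqP eR /eqP eS.
  have [gw _ _ _] := WP w wW; split=> //.
  - case/and4P: gw => + _ _ _; rewrite /wprod !mulf_eq0 !negb_or.
    move=> /andP[/andP[b10 _] _]; apply: (mulfI b10); apply: (mulfI D0).
    by rewrite eP /wprod; field.
  - case/and4P: gw => + _ _ _; rewrite /wprod !mulf_eq0 !negb_or.
    move=> /andP[_ b30]; apply: (mulfI b30); apply: (mulfI D0).
    by rewrite eS /wprod; field.
  - case/and4P: gw => + _ _ _; rewrite /wprod !mulf_eq0 !negb_or.
    move=> /andP[/andP[b10 _] b30]; apply: (mulfI (mulf_neq0 b10 b30)).
    apply: (mulfI D0); transitivity (D * (mu * w.1.1 * w.2 * wQ mu w)).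
      by ring.
    by rewrite eQ /wprod; field.
  - by apply: (mulfI D0); rewrite eR; field.
apply: (@leq_trans #|C 1 :|: C (- 1)|).
  apply/subset_leq_card/subsetP => w wW; have [gw k1 k2 k3] := WP w wW.
  have [e] := same_moebius lam_neq0 D0 n12 n23 n31 k1 k2 k3 h1 h2 h3.
  rewrite in_cons mem_seq1 in_setU => eE [eP eQ eR eS].
  have : w \in C e by rewrite inE wW /=; apply/and4P; split; apply/eqP.
  by case/orP: eE => /eqP -> ->; rewrite ?orbT.
by rewrite (leq_trans (leq_card_setU _ _)) // (leq_add (C2 _) (C2 _)).
Qed.

End GenericFibre.

(** * Walks and cross ratios *)

Section Walks.

Variables (F : finFieldType) (mu : F).
Hypotheses (mu_neq0 : mu != 0) (lam_neq0 : 1 + mu != 0).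
Variables (A B : {set F}) (n K : nat).
Hypotheses (An : (#|A| <= n)%N) (Bn : (#|B| <= n)%N) (B0 : 0 \notin B).
Hypotheses (n_gt0 : (0 < n)%N) (K_gt0 : (0 < K)%N).

Definition swap_triples : {set F * (F * F)} :=
  [set t | [&& t.1 \in A, t.2.1 \in B, t.2.2 \in A & swapped mu t.2.1 t.1
    t.2.2]].

Hypothesis many_triples : (n ^ 2 <= K * #|swap_triples|)%N.

Let neqB b : b \in B -> b != 0.
Proof. by move=> bB; apply: contraNneq B0 => <-. Qed.

Definition word_act (w : F * F * F) (x : F) : F :=
  swap mu w.1.1 (swap mu w.1.2 (swap mu w.2 x)).

(** Every step of the walk must stay in [A] and satisfy [swapped], so that no junk value of [swap]
    intervenes. *)
Definition word_dom (w : F * F * F) : {set F} :=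
  [set x in A | let y1 := swap mu w.2 x in let y2 := swap mu w.1.2 y1 in
     [&& y1 \in A, y2 \in A, word_act w x \in A, swapped mu w.2 x y1,
         swapped mu w.1.2 y1 y2 & swapped mu w.1.1 y2 (word_act w x)]].

Let U (x : F) : {set F * F} :=
  [set u | [&& u.1 \in B, u.2 \in A & swapped mu u.1 x u.2]].
Let A1 : {set F} := [set x in A | (n <= 4 * K * #|U x|)%N].
Let T1 : {set F * (F * F)} :=
  [set t in swap_triples | (t.1 \in A1) && (t.2.2 \in A1)].
Let words : {set F * F * F} := setX (setX B B) B.

(** Starting points of degree below n / (4K) carry at most n^2 / (4K) triples; by the symmetry of
    [swapped] the same holds for end points, and half of the triples survive. *)
Lemma popular_triples : (n ^ 2 <= 2 * K * #|T1|)%N.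
Proof.
pose S1 := [set t in swap_triples | t.1 \notin A1].
pose S2 := [set t in swap_triples | t.2.2 \notin A1].
have cS1 : (4 * K * #|S1| <= n ^ 2)%N.
  have -> : S1 = swap_triples :&: setX (A :\: A1) setT.
    apply/setP => -[x u]; rewrite in_setI in_setX in_setT andbT in_setD inE.
    case tT: ((x, u) \in swap_triples) => //=.
    by move: tT; rewrite inE => /and4P[-> _ _ _]; rewrite andbT.
  rewrite -sum_card_fibre big_distrr /=.
  apply: (@leq_trans (\sum_(x in A :\: A1) n)).
    apply: leq_sum => x; rewrite !inE => /andP[+ xA]; rewrite xA /= -ltnNge.
    move=> /ltnW; apply: leq_trans; rewrite leq_mul2l; apply/orP; right.
    by apply/subset_leq_card/subsetP => u; rewrite !inE /= => /and4P[_ -> ->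
      ->].
  rewrite sum_nat_const -mulnn leq_mul2r (leq_trans _ An) ?orbT //.
  exact/subset_leq_card/subsetDl.
have cS2 : (#|S2| <= #|S1|)%N.
  pose s (t : F * (F * F)) := (t.2.2, (t.2.1, t.1)).
  have s_inj : injective s by move=> [x [b y]] [x' [b' y']] [-> -> ->].
  rewrite -(card_imset _ s_inj); apply/subset_leq_card/subsetP.
  move=> _ /imsetP[[x [b y]] + ->]; rewrite !inE /=.
  by case/andP=> /and4P[-> -> -> sw] ->; rewrite swappedC sw.
have : (#|swap_triples| <= #|T1| + (#|S1| + #|S2|))%N.
  apply: (@leq_trans #|T1 :|: (S1 :|: S2)|).
    apply/subset_leq_card/subsetP => t tT; rewrite !in_setU.
    rewrite [t \in T1]inE [t \in S1]inE [t \in S2]inE tT /=.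
    by case: (t.1 \in A1) => //=; case: (t.2.2 \in A1).
  rewrite (leq_trans (leq_card_setU _ _)) // leq_add2l.
  by rewrite (leq_trans (leq_card_setU _ _)).
move=> H; have : (4 * K * #|swap_triples| <= 4 * K * (#|T1| + (#|S1| +
  #|S1|)))%N.
  by rewrite leq_mul2l (leq_trans H) ?orbT // !leq_add2l.
move: many_triples cS1; clear; nia.
Qed.

(** A triple of [T1] serves as the middle step of a walk and extends at each end in n / (4K) ways,
    whence 32 = 2 * 4^2. The word and the starting point determine the walk. *)
Lemma many_walks : (n ^ 4 <= 32 * K ^ 3 * \sum_(w in words) #|word_dom w|)%N.
Proof.
pose G := [set v : (F * (F * F)) * ((F * F) * (F * F)) |
  v.2 \in setX (U v.1.1) (U v.1.2.2)].
have cG : (#|T1| * n ^ 2 <= 16 * K ^ 2 * #|G :&: setX T1 setT|)%N.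
  rewrite -sum_card_fibre big_distrr /= -sum_nat_const.
  apply: leq_sum => t /setIdP[_ /andP[/setIdP[_ U1] /setIdP[_ U2]]].
  have -> : [set b in setT | (t, b) \in G] = setX (U t.1) (U t.2.2).
    by apply/setP => v; rewrite !inE.
  rewrite cardsX (leq_trans (leq_mul U1 U2)) // leq_eqVlt.
  by apply/orP; left; apply/eqP; ring.
pose D := [set v : (F * F * F) * F | v.2 \in word_dom v.1].
have eD : (\sum_(w in words) #|word_dom w| = #|D :&: setX words setT|)%N.
  rewrite -sum_card_fibre; apply: eq_bigr => w _; apply: eq_card => x.
  by rewrite !inE.
pose f (v : (F * (F * F)) * ((F * F) * (F * F))) : (F * F * F) * F :=
  ((v.2.2.1, v.1.2.1, v.2.1.1), v.2.1.2).
have GP x1 b2 x2 b3 x0 b1 x3 :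
    ((x1, (b2, x2)), ((b3, x0), (b1, x3))) \in G :&: setX T1 setT ->
    [/\ [/\ b1 \in B, b2 \in B & b3 \in B],
        [/\ x0 \in A, x1 \in A, x2 \in A & x3 \in A],
        [/\ swapped mu b3 x0 x1, swapped mu b2 x1 x2 & swapped mu b1 x2 x3] &
        [/\ x1 = swap mu b3 x0, x2 = swap mu b2 x1 & x3 = swap mu b1 x2]].
  rewrite in_setI => /andP[]; rewrite inE => /setXP[] /=.
  rewrite inE /= => /and3P[b3B x0A]; rewrite swappedC => s1.
  rewrite inE /= => /and3P[b1B x3A s3] /setXP[/= /setIdP[+ _] _].
  rewrite inE /= => /and4P[x1A b2B x2A s2].
  by split; split=> //; apply: swappedE => //; apply: neqB.
have f_inj : {in G :&: setX T1 setT &, injective f}.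
  move=> [[x1 [b2 x2]] [[b3 x0] [b1 x3]]] [[y1 [c2 y2]] [[c3 y0] [c1 y3]]].
  move=> /GP[_ _ _ [-> -> ->]] /GP[_ _ _ [-> -> ->]].
  by rewrite /f /= => -[-> -> -> ->].
have cW : (#|G :&: setX T1 setT| <= #|D :&: setX words setT|)%N.
  rewrite -(card_in_imset f_inj); apply/subset_leq_card/subsetP.
  move=> _ /imsetP[[[x1 [b2 x2]] [[b3 x0] [b1 x3]]] /GP + ->].
  case=> [[b1B b2B b3B] [x0A x1A x2A x3A] [s1 s2 s3] [e1 e2 e3]].
  rewrite !inE /= /word_act /= -e1 -e2 -e3.
  by rewrite x0A x1A x2A x3A s1 s2 s3 b1B b2B b3B.
rewrite eD; have := leq_mul popular_triples (leqnn (n ^ 2)).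
rewrite -expnD => /leq_trans-> //.
rewrite -mulnA (leq_trans (leq_mul (leqnn (2 * K)) cG)) //.
apply: (@leq_trans (2 * K * (16 * K ^ 2 * #|D :&: setX words setT|))).
  by rewrite !leq_mul2l cW !orbT.
by rewrite leq_eqVlt; apply/orP; left; apply/eqP; ring.
Qed.

(** Since all letters are nonzero, each of the three degeneracies expresses one letter through the
    other two. *)
Lemma card_nongeneric : (#|[set w in words | ~~ generic w]| <= 3 * n ^ 2)%N.
Proof.
pose E1 := [set ((u.1, u.1), u.2) | u in setX B B].
pose E2 := [set ((u.1, u.2), u.2) | u in setX B B].
pose E3 := [set ((u.1, u.2), u.2 ^+ 2 / u.1) | u in setX B B].
have cE (f : F * F -> F * F * F) : (#|f @: setX B B| <= n ^ 2)%N.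
  by rewrite (leq_trans (leq_imset_card _ _)) // cardsX -mulnn leq_mul.
apply: (@leq_trans #|E1 :|: (E2 :|: E3)|); last first.
  rewrite (leq_trans (leq_card_setU _ _)) // mulSn leq_add ?cE //.
  rewrite (leq_trans (leq_card_setU _ _)) // mulSn leq_add ?cE // mul1n.
  exact: cE.
apply/subset_leq_card/subsetP => -[[b1 b2] b3].
rewrite inE => /andP[/setXP[/setXP[/= b1B b2B] b3B]].
rewrite /generic /wprod /= !mulf_eq0 !negb_or !neqB //=.
rewrite !negb_and !negbK !in_setU => /or3P[] /eqP e.
- apply/orP; left; apply/imsetP; exists (b2, b3); rewrite ?e //.
  by rewrite !inE /= b2B b3B.
- apply/orP; right; apply/orP; left; apply/imsetP; exists (b1, b3);
  rewrite ?e //.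
  by rewrite !inE /= b1B b3B.
apply/orP; right; apply/orP; right; apply/imsetP; exists (b1, b2).
  by rewrite !inE /= b1B b2B.
by rewrite /= -e (mulrC b1) mulfK // neqB.
Qed.

(** With L = 128 K^3 the walks number at least 4 n^4 / L. The non-generic words account for at most
    3 n^3 <= 2 n^4 / L by the lower bound on n, and the words with small domain for at most n^4 / L;
    the remaining n^4 / L is shared by words with at most n walks each. *)
Lemma many_rich_words : (192 * K ^ 3 <= n)%N ->
  exists2 W : {set F * F * F}, (n ^ 3 <= 128 * K ^ 3 * #|W|)%N &
    forall w, w \in W -> [/\ w \in words, generic w &
      (n <= 128 * K ^ 3 * #|word_dom w|)%N].
Proof.
move=> Kn; set L := (128 * K ^ 3)%N.
exists [set w in words | generic w & (n <= L * #|word_dom w|)%N]; last first.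
  by move=> w; rewrite inE => /and3P.
set W := [set w in _ | _].
pose N0 := [set w in words | ~~ generic w].
pose N1 := [set w in words | (L * #|word_dom w| < n)%N].
have dn w : (#|word_dom w| <= n)%N.
  rewrite (leq_trans _ An) // subset_leq_card //.
  by apply/subsetP => x; rewrite inE => /andP[].
have split3 : (\sum_(w in words) #|word_dom w| <= \sum_(w in W) #|word_dom w| +
    (\sum_(w in N0) #|word_dom w| + \sum_(w in N1) #|word_dom w|))%N.
  rewrite (big_setID W) /= leq_add //.
    rewrite (setIidPr _) //; apply/subsetP => w; rewrite inE.
    by case/andP.
  rewrite big_mkcond [X in (_ <= X + _)%N]big_mkcond.
  rewrite [X in (_ <= _ + X)%N]big_mkcond -big_split /=; apply: leq_sum => w _.
  case: ifP => //; rewrite in_setD => /andP[+ ww]; rewrite inE ww /=.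
  rewrite negb_and -ltnNge [w \in N0]inE [w \in N1]inE ww /=.
  by case: (generic w) => /= [->|_]; rewrite ?add0n // leq_addr.
have h0 : (\sum_(w in N0) #|word_dom w| <= 3 * n ^ 2 * n)%N.
  apply: (@leq_trans (\sum_(w in N0) n)); first exact: leq_sum.
  by rewrite sum_nat_const leq_mul2r card_nongeneric orbT.
have h1 : (L * \sum_(w in N1) #|word_dom w| <= n ^ 4)%N.
  rewrite big_distrr /=; apply: (@leq_trans (\sum_(w in words) n)).
    rewrite big_mkcond [leqRHS]big_mkcond /=; apply: leq_sum => w _.
    by rewrite inE; case: (w \in words) => //=; case: ltnP => // /ltnW.
  rewrite sum_nat_const !cardsX expnSr leq_mul2r; apply/orP; right.
  by rewrite expnSr leq_mul // -mulnn leq_mul.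
have h2 : (\sum_(w in W) #|word_dom w| <= #|W| * n)%N.
  by rewrite -sum_nat_const; apply: leq_sum.
rewrite -(leq_pmul2r n_gt0) -expnSr.
have h3 := leq_trans many_walks (leq_mul (leqnn _) split3).
have h0L : (L * \sum_(w in N0) #|word_dom w| <= 2 * n ^ 4)%N.
  apply: (@leq_trans (L * (3 * n ^ 2 * n))); first by rewrite leq_mul2l h0 orbT.
  rewrite (_ : L * _ = 2 * (192 * K ^ 3 * n ^ 3))%N; last by rewrite /L; ring.
  by rewrite (expnS n 3) leq_mul2l leq_mul2r Kn !orbT.
have h2L : (L * \sum_(w in W) #|word_dom w| <= L * #|W| * n)%N.
  by rewrite -mulnA leq_mul2l h2 orbT.
have LE : L = (4 * (32 * K ^ 3))%N by rewrite mulnA.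
move: h3 h0L h1 h2L; rewrite LE -!mulnA; clear.
move: (\sum_(w in W) _)%N (\sum_(w in N0) _)%N (\sum_(w in N1) _)%N.
by move: (n ^ 4)%N (K ^ 3)%N #|W| => x y z s1 s2 s3; lia.
Qed.

End Walks.

Lemma card_le_fibre (aT rT : finType) (f : aT -> rT) (D : {set aT}) (c : nat) :
    (forall y, (#|[set x in D | f x == y]| <= c)%N) ->
  (#|D| <= c * #|f @: D|)%N.
Proof.
move=> fc; rewrite -sum1_card (partition_big f (mem (f @: D))) /=; last first.
  by move=> x xD; apply: imset_f.
rewrite mulnC -sum_nat_const; apply: leq_sum => y _.
by rewrite sum1dep_card.
Qed.

Lemma pigeonhole_fibre (aT rT : finType) (f : aT -> rT) (D : {set aT})
    (T : {set rT}) : T != set0 -> {in D, forall x, f x \in T} ->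
  exists2 y, y \in T & (#|D| <= #|T| * #|[set x in D | f x == y]|)%N.
Proof.
move=> /set0Pn[y0 y0T] fT.
case: (@arg_maxnP _ y0 (mem T) (fun y => #|[set x in D | f x == y]|) y0T) =>
  y yT ymax; exists y => //.
rewrite -sum1_card (partition_big f (mem T)) //= -sum_nat_const.
by apply: leq_sum => z zT; rewrite sum1dep_card; apply: ymax.
Qed.

(** * Cross ratios and the chart with a point at infinity *)

Section CrossRatio.

Variable F : finFieldType.

Definition quad : finType := {ffun 'I_4 -> F}.

Let o0 : 'I_4 := @Ordinal 4 0 isT.
Let o1 : 'I_4 := @Ordinal 4 1 isT.
Let o2 : 'I_4 := @Ordinal 4 2 isT.
Let o3 : 'I_4 := @Ordinal 4 3 isT.

(** Normalised so that moving entry 0 to infinity leaves (x1 - x2) / (x1 - x3), the weight c in x2 =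
    (1 - c) x1 + c x3. *)
Definition cross_ratio (x : quad) : F :=
  (x o1 - x o2) * (x o3 - x o0) / ((x o1 - x o3) * (x o2 - x o0)).

Definition quads (X : {set F}) : {set quad} :=
  [set x | (x \in ffun_on (mem X)) && injectiveb x].

Lemma card_quads (X : {set F}) : #|quads X| = (#|X| ^_ 4)%N.
Proof. by rewrite card_inj_ffuns_on card_ord. Qed.

Lemma quads_inj (X : {set F}) (x : quad) : x \in quads X -> injective x.
Proof. by rewrite inE => /andP[_ /injectiveP]. Qed.

Lemma quads_mem (X : {set F}) (x : quad) (i : 'I_4) : x \in quads X -> x i \in
  X.
Proof. by rewrite inE => /andP[/ffun_onP + _]; apply. Qed.

Lemma quads_neq (X : {set F}) (x : quad) (i j : 'I_4) :
  x \in quads X -> i != j -> x i - x j != 0.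
Proof. by move=> /quads_inj xI; rewrite subr_eq0 (inj_eq xI). Qed.

Definition chart (A : {set F}) (v : F) : {set F} :=
  [set (a - v)^-1 | a in A :\ v].

Lemma card_chart (A : {set F}) (v : F) : (#|chart A v| <= #|A|)%N.
Proof.
by rewrite (leq_trans (leq_imset_card _ _)) // subset_leq_card ?subsetDl.
Qed.

Lemma cross_ratio_chart (A : {set F}) (x : quad) : x \in quads A ->
  (x o2 - x o0)^-1 = (1 - cross_ratio x) * (x o1 - x o0)^-1 +
    cross_ratio x * (x o3 - x o0)^-1.
Proof.
move=> xA; have n := quads_neq xA.
rewrite /cross_ratio; field.
by rewrite !n.
Qed.

Lemma chart_mem (A : {set F}) (x : quad) (i : 'I_4) :
  x \in quads A -> i != o0 -> (x i - x o0)^-1 \in chart A (x o0).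
Proof.
move=> xA i0; apply/imsetP; exists (x i) => //.
by rewrite in_setD1 quads_mem // (inj_eq (quads_inj xA)) i0.
Qed.

Lemma cross_ratio_neq01 (A : {set F}) (x : quad) : x \in quads A ->
  cross_ratio x != 0 /\ cross_ratio x != 1.
Proof.
move=> xA; have n := quads_neq xA; split.
  by rewrite mulf_neq0 ?invr_eq0 ?mulf_neq0 ?n.
apply/eqP => cr1; have := cross_ratio_chart xA.
rewrite cr1 subrr mul0r add0r mul1r => /invr_inj/addIr/(quads_inj xA).
by move/eqP.
Qed.

Definition quads_over (A : {set F}) (v xi : F) : {set quad} :=
  [set x in quads A | (x o0 == v) && (cross_ratio x == xi)].

(** In the chart at v, entries 1 and 3 determine entry 2 through [cross_ratio_chart]. *)
Lemma card_quads_over (A : {set F}) (v xi : F) :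
  (#|quads_over A v xi| <= #|[set u in setX (chart A v) (chart A v) |
      (1 - xi) * u.1 + xi * u.2 \in chart A v]%R|)%N.
Proof.
pose f (x : quad) := ((x o1 - v)^-1, (x o3 - v)^-1).
have f_inj : {in quads_over A v xi &, injective f}.
  move=> x y /setIdP[xA /andP[/eqP x0 /eqP xc]] /setIdP[yA /andP[/eqP y0 /eqP
    yc]].
  case=> e1 e3; have := cross_ratio_chart xA; have := cross_ratio_chart yA.
  rewrite x0 y0 xc yc e1 e3 => <- /invr_inj/addIr e2.
  move: e1 e3 => /invr_inj/addIr e1 /invr_inj/addIr e3.
  apply/ffunP => -[[|[|[|[|//]]]] i]; rewrite (bool_irrelevance i isT) //.
  by rewrite -[LHS]/(x o0) -[RHS]/(y o0) x0 y0.
rewrite -(card_in_imset f_inj); apply/subset_leq_card/subsetP.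
move=> _ /imsetP[x /setIdP[xA /andP[/eqP x0 /eqP xc]] ->].
rewrite inE in_setX /= -x0 !chart_mem //= -xc.
by rewrite -(cross_ratio_chart xA) chart_mem.
Qed.

Lemma card_quads_at (A : {set F}) (v : F) :
  (#|[set x in quads A | x o0 == v]| <= #|A| ^ 3)%N.
Proof.
pose f (x : quad) := ((x o1, x o2), x o3).
have f_inj : {in [set x in quads A | x o0 == v] &, injective f}.
  move=> x y /setIdP[_ /eqP x0] /setIdP[_ /eqP y0] [e1 e2 e3].
  apply/ffunP => -[[|[|[|[|//]]]] i]; rewrite (bool_irrelevance i isT) //.
  by rewrite -[LHS]/(x o0) -[RHS]/(y o0) x0 y0.
rewrite -(card_in_imset f_inj) 2!expnSr expn1 -!cardsX.
apply/subset_leq_card/subsetP => _ /imsetP[x /setIdP[xA _] ->].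
by rewrite !in_setX !quads_mem.
Qed.

(** Some pair of base points (v, y) carries n^5 / c pairs of quadruples. At most n^3 quadruples
    start at v, so cross ratios with fewer than n^2 / (2c) quadruples over y account for at most
    half of these pairs. Each remaining cross ratio has at most n^2 quadruples over each base point,
    so there are at least n / (2c) of them. The chart is taken at y. *)
Lemma cross_ratio_energy (A : {set F}) (n c : nat)
    (Th : {set quad * quad}) : (#|A| <= n)%N -> (0 < n)%N -> (0 < c)%N ->
    (n ^ 7 <= c * #|Th|)%N ->
    (forall u, u \in Th -> [/\ u.1 \in quads A, u.2 \in quads A &
       cross_ratio u.1 = cross_ratio u.2]) ->
  exists (v : F) (Xi : {set F}), [/\ (n <= 2 * c * #|Xi|)%N, 0 \notin Xi,
    1 \notin Xi & forall xi, xi \in Xi -> (n ^ 2 <= 2 * c *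
      #|[set u in setX (chart A v) (chart A v) |
          (1 - xi) * u.1 + xi * u.2 \in chart A v]%R|)%N].
Proof.
move=> An n_gt0 c_gt0 nTh ThP.
have Th_gt0 : (0 < #|Th|)%N.
  by rewrite lt0n; apply: contraTneq nTh => ->; rewrite muln0 -ltnNge expn_gt0
    n_gt0.
have [u0 u0Th] : exists u, u \in Th by apply/set0Pn; rewrite -card_gt0.
pose f (u : quad * quad) := (u.1 o0, u.2 o0).
have fA : {in Th, forall u, f u \in setX A A}.
  by move=> u /ThP[u1 u2 _]; rewrite in_setX !quads_mem.
have nA : setX A A != set0 by apply/set0Pn; exists (f u0); apply: fA.
have [[v y] _ vyTh] := pigeonhole_fibre nA fA.
set Th1 := [set u in Th | _] in vyTh.
have n5 : (n ^ 5 <= c * #|Th1|)%N.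
  rewrite -(@leq_pmul2r (n ^ 2)) ?expn_gt0 ?n_gt0 // -expnD (leq_trans nTh) //.
  rewrite -mulnA leq_mul2l (leq_trans vyTh) ?orbT // mulnC leq_mul2l.
  by rewrite cardsX -mulnn leq_mul ?orbT.
pose Qv := [set x in quads A | x o0 == v].
pose R xi := #|quads_over A y xi|.
have Th1R : (#|Th1| <= \sum_(x in Qv) R (cross_ratio x))%N.
  pose G := [set u : quad * quad | u.2 \in quads_over A y (cross_ratio u.1)].
  have -> : (\sum_(x in Qv) R (cross_ratio x) = #|G :&: setX Qv setT|)%N.
    by rewrite -sum_card_fibre; apply: eq_bigr => x _; apply: eq_card => z;
      rewrite !inE.
  apply/subset_leq_card/subsetP => u /setIdP[/ThP[u1 u2 cr] /eqP[e1 e2]].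
  rewrite in_setI inE inE u2 e2 cr !eqxx /=; case: u u1 e1 {u2 e2 cr} => x z /=
    u1 e1.
  by rewrite in_setX in_setT inE u1 e1 eqxx.
pose Xi := [set xi | (n ^ 2 <= 2 * c * R xi)%N].
have XiP xi : xi \in Xi -> exists2 x, x \in quads A & cross_ratio x = xi.
  rewrite inE => h; suff /card_gt0P[x] : (0 < R xi)%N.
    by case/setIdP=> xA /andP[_ /eqP]; exists x.
  rewrite lt0n; apply: contraTneq h => ->.
  by rewrite muln0 -ltnNge expn_gt0 n_gt0.
have n2R w xi : (#|quads_over A w xi| <= n ^ 2)%N.
  rewrite (leq_trans (card_quads_over _ _ _)) //.
  rewrite (@leq_trans #|setX (chart A w) (chart A w)|) //.
    by apply/subset_leq_card/subsetP => u; rewrite inE => /andP[].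
  by rewrite cardsX -mulnn leq_mul // (leq_trans (card_chart _ _)).
exists y, Xi; split.
- pose s1 := (\sum_(x in Qv :&: [set x | cross_ratio x \in Xi]) R (cross_ratio
  x))%N.
  pose s2 := (\sum_(x in Qv :\: [set x | cross_ratio x \in Xi]) R (cross_ratio
    x))%N.
  have ss : (\sum_(x in Qv) R (cross_ratio x) = s1 + s2)%N by rewrite
    -big_setID.
  have h2 : (2 * c * s2 <= n ^ 5)%N.
    rewrite big_distrr /=; apply: (@leq_trans (\sum_(x in Qv) n ^ 2)%N).
      rewrite big_mkcond [leqRHS]big_mkcond /=; apply: leq_sum => x _.
      rewrite in_setD inE; case: (x \in Qv); rewrite ?andbF // andbT.
      by case: ifP => //; rewrite inE -ltnNge => /ltnW.
    rewrite sum_nat_const (expnD n 3 2) leq_mul2r (leq_trans (card_quads_at _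
      _)) ?orbT //.
    by rewrite leq_exp2r.
  have h1 : (s1 <= #|Xi| * n ^ 2 * n ^ 2)%N.
    apply: (@leq_trans (\sum_(x in Qv :&: [set x | cross_ratio x \in Xi]) n ^
      2)%N).
      by apply: leq_sum => x _; apply: n2R.
    rewrite sum_nat_const leq_mul2r; apply/orP; right.
    rewrite -sum1_card (partition_big cross_ratio (mem Xi)) /=; last first.
      by move=> x; rewrite !inE => /andP[].
    rewrite -sum_nat_const; apply: leq_sum => xi _; rewrite sum1dep_card.
    rewrite (leq_trans _ (n2R v xi)) // subset_leq_card //.
    apply/subsetP => x; rewrite inE => /andP[/setIP[/setIdP[xA x0] _] cx].
    by rewrite inE xA x0.
  rewrite -(@leq_pmul2r (n ^ 4)) ?expn_gt0 ?n_gt0 // -expnS.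
  have h3 : (c * #|Th1| <= c * (s1 + s2))%N by rewrite leq_mul2l -ss Th1R orbT.
  have h4 : (2 * c * s1 <= 2 * c * (#|Xi| * n ^ 2 * n ^ 2))%N.
    by rewrite leq_mul2l h1 orbT.
  have e4 : (2 * c * #|Xi| * n ^ 4 = 2 * c * (#|Xi| * n ^ 2 * n ^ 2))%N by ring.
  rewrite e4; move: n5 h2 h3 h4; clear; rewrite -!mulnA.
  by move: s1 s2 (n ^ 5)%N #|Th1| (n ^ 2)%N #|Xi| => s1 s2 x t z q; lia.
- by apply/negP => /XiP[x /cross_ratio_neq01[+ _] e]; rewrite e eqxx.
- by apply/negP => /XiP[x /cross_ratio_neq01[_ +] e]; rewrite e eqxx.
move=> xi; rewrite inE => /leq_trans-> //.
by rewrite leq_mul2l card_quads_over orbT.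
Qed.

End CrossRatio.

(** For m >= 6 each of the four factors of the falling factorial is at least m / 2. *)
Lemma leq_ffact4 (m : nat) : (6 <= m)%N -> (m ^ 4 <= 16 * m ^_ 4)%N.
Proof.
move=> m6; have [k mk] : exists k, m = (k + 6)%N by exists (m - 6)%N;
  rewrite subnK.
rewrite !ffactnS ffactn0 muln1 mk !addnS !addn0 /=; nia.
Qed.

(** The first two terms are thresholds, for [many_rich_words] and for domains of at least 6 points.
    In c, the 64 is 16 from [leq_ffact4] times the fibre bound 4, and the 2 comes from
    [cross_ratio_energy]. *)
Definition moebius_const (K : nat) : nat :=
  let L := (128 * K ^ 3)%N in let c := (2 * (64 * L ^ 5))%N in
  (192 * K ^ 3 + 6 * L + dilate_const c (3072 * c ^ 5))%N.

Section MoebiusBound.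

Variables (F : finFieldType) (mu : F).
Hypotheses (mu_neq0 : mu != 0) (lam_neq0 : 1 + mu != 0).
Variables (A B : {set F}) (n K : nat).
Hypotheses (An : (#|A| <= n)%N) (Bn : (#|B| <= n)%N) (B0 : 0 \notin B).
Hypotheses (n_gt0 : (0 < n)%N) (K_gt0 : (0 < K)%N).
Hypothesis many_triples : (n ^ 2 <= K * #|swap_triples mu A B|)%N.

Lemma word_domP (w : F * F * F) (x : F) :
    w \in setX (setX B B) B -> x \in word_dom mu A w ->
  [/\ x \in A, word_act mu w x \in A, wden mu w x != 0 &
      wnum mu w x = wden mu w x * word_act mu w x].
Proof.
case: w => -[b1 b2] b3 /setXP[/setXP[/= b1B b2B] b3B].
have nB b : b \in B -> b != 0 by move=> bB; apply: contraNneq B0 => <-.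
case/setIdP=> xA /and5P[_ _ zA s1 /andP[s2 s3]].
by have [d0 e] := word_action lam_neq0 (nB _ b1B) (nB _ b2B) (nB _ b3B) s1 s2
  s3.
Qed.

Definition quad_act (w : F * F * F) (x : quad F) : quad F :=
  [ffun i => word_act mu w (x i)].

(** By [moebius_sub] a difference of images is the original difference times the determinant over
    two denominators; in the cross ratio all these factors cancel. *)
Lemma quad_actP (w : F * F * F) (x : quad F) :
    w \in setX (setX B B) B -> generic w -> x \in quads (word_dom mu A w) ->
  [/\ x \in quads A, quad_act w x \in quads A &
      cross_ratio x = cross_ratio (quad_act w x)].
Proof.
move=> wB gw xD; have D i := word_domP wB (quads_mem i xD).
have xA : x \in quads A.
  rewrite inE; apply/andP; split; last exact/injectiveP/(quads_inj xD).
  by apply/ffun_onP => i; have [] := D i.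
have k0 : - ((1 + mu) ^+ 3 * wprod w ^+ 2) != 0.
  by case/and4P: gw => w0 _ _ _; rewrite oppr_eq0 mulf_neq0 ?expf_neq0.
have sub i j : word_act mu w (x i) - word_act mu w (x j) =
    - ((1 + mu) ^+ 3 * wprod w ^+ 2) * (x i - x j) /
    (wden mu w (x i) * wden mu w (x j)).
  have [_ _ di ei] := D i; have [_ _ dj ej] := D j.
  by rewrite -(moebius_sub ei ej); field; rewrite di dj.
split=> //.
  rewrite inE; apply/andP; split.
    by apply/ffun_onP => i; rewrite ffunE; have [] := D i.
  apply/injectiveP => i j /eqP; rewrite !ffunE -subr_eq0 sub.
  have [_ _ di _] := D i; have [_ _ dj _] := D j.
  rewrite !mulf_eq0 invr_eq0 mulf_eq0 (negPf di) (negPf dj) (negPf k0) !orbF /=.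
  by rewrite subr_eq0 => /eqP/(quads_inj xD).
have nx := quads_neq xD.
rewrite /cross_ratio !ffunE !sub.
move: k0; move: (- _) => k k0.
set i0 := Ordinal _; set i1 := Ordinal _; set i2 := Ordinal _;
  set i3 := Ordinal _.
have [_ _ d0 _] := D i0; have [_ _ d1 _] := D i1.
have [_ _ d2 _] := D i2; have [_ _ d3 _] := D i3.
field; rewrite k0 d0 d1 d2 d3 /=.
by rewrite !nx.
Qed.

Lemma moebius_bound :
    (forall S : {set F}, 0 \in S -> {in S, forall x,
      x + 1 \in S} -> S = setT) ->
    (n ^ 2 <= K * #|F|)%N ->
  (n <= moebius_const K)%N.
Proof.
move=> F_cyclic nF; rewrite /moebius_const.
set L := (128 * K ^ 3)%N; set c := (64 * L ^ 5)%N.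
have L_gt0 : (0 < L)%N by rewrite muln_gt0 expn_gt0 K_gt0.
have [small|large] := leqP n (192 * K ^ 3 + 6 * L).
  by rewrite (leq_trans small) // leq_addr.
have Kn : (192 * K ^ 3 <= n)%N by rewrite (leq_trans _ (ltnW large)) //
  leq_addr.
have Ln : (6 * L <= n)%N by rewrite (leq_trans _ (ltnW large)) // leq_addl.
have [W nW WP] := many_rich_words lam_neq0 An Bn B0 n_gt0 many_triples Kn.
pose Om := [set v : (F * F * F) * quad F |
  (v.1 \in W) && (v.2 \in quads (word_dom mu A v.1))].
pose f (v : (F * F * F) * quad F) := (v.2, quad_act v.1 v.2).
have cOm : (n ^ 7 <= 16 * L ^ 5 * #|Om|)%N.
  have -> : #|Om| = (\sum_(w in W) #|word_dom mu A w| ^_ 4)%N.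
    pose G := [set v : (F * F * F) * quad F | v.2 \in quads (word_dom mu A
      v.1)].
    have -> : Om = G :&: setX W setT.
      by apply/setP => -[w x]; rewrite in_setI in_setX !inE andbT andbC.
    rewrite -sum_card_fibre; apply: eq_bigr => w _; rewrite -card_quads.
    by apply: eq_card => x; rewrite !inE.
  have : (n ^ 3 * n ^ 4 <= L * #|W| * n ^ 4)%N by rewrite leq_mul2r nW orbT.
  rewrite -expnD => /leq_trans-> //.
  rewrite (_ : 16 * L ^ 5 * _ = L * (16 * L ^ 4 *
    \sum_(w in W) #|word_dom mu A w| ^_ 4))%N; last by ring.
  rewrite -mulnA leq_mul2l; apply/orP; right.
  rewrite big_distrr -sum_nat_const /=; apply: leq_sum => w /WP[_ _ nw].
  have m6 : (6 <= #|word_dom mu A w|)%N.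
    by rewrite -(leq_pmul2l L_gt0) mulnC (leq_trans Ln).
  apply: (@leq_trans ((L * #|word_dom mu A w|) ^ 4));
    first by rewrite leq_exp2r.
  rewrite expnMn -mulnA (mulnCA 16) leq_mul2l leq_ffact4 ?orbT //.
(* A pair of quadruples prescribes the Moebius map at four points; the first three suffice for
   [card_generic_fibre]. *)
have fib u : (#|[set v in Om | f v == u]| <= 4)%N.
  case: u => x z; pose W1 := [set v.1 | v in [set v in Om | f v == (x, z)]].
  have -> : #|[set v in Om | f v == (x, z)]| = #|W1|.
    rewrite card_in_imset // => -[w y] [w' y'] /setIdP[_ /eqP[-> _]].
    by move=> /setIdP[_ /eqP[-> _]] /= ->.
  have [->|[w0]] := set_0Vmem W1; first by rewrite cards0.
  case/imsetP=> -[w1 y] /setIdP[/setIdP[_ /= yD] /eqP[yx _]] _.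
  rewrite {}yx in yD; have nx := quads_neq yD.
  pose j (k : nat) (lt4 : (k < 4)%N) := x (Ordinal lt4).
  apply: (@card_generic_fibre _ _ mu_neq0 lam_neq0 W1 (j 0 isT) (j 1 isT) (j 2
    isT)
    (z (@Ordinal 4 0 isT)) (z (@Ordinal 4 1 isT)) (z (@Ordinal 4 2 isT))).
  - by rewrite -subr_eq0 nx.
  - by rewrite -subr_eq0 nx.
  - by rewrite -subr_eq0 nx.
  move=> w /imsetP[[w' x'] /setIdP[/setIdP[/= w'W x'D] /eqP[ex ez]] /= ->].
  rewrite ex in x'D ez *; have [wB gw _] := WP w' w'W; rewrite -ez !ffunE.
  have D i := word_domP wB (quads_mem i x'D).
  split=> //; [have [] := D (@Ordinal 4 0 isT)|have [] := D (@Ordinal 4 1 isT)|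
    have [] := D (@Ordinal 4 2 isT)] => //.
have nTh : (n ^ 7 <= c * #|f @: Om|)%N.
  rewrite (leq_trans cOm) // (_ : c = 16 * L ^ 5 * 4)%N; last by rewrite /c;
    ring.
  by rewrite -[leqRHS]mulnA leq_mul2l (card_le_fibre fib) orbT.
have c_gt0 : (0 < c)%N by rewrite muln_gt0 expn_gt0 L_gt0.
have K_le_c : (K <= 2 * c)%N.
  rewrite /c mulnA (leq_trans _ (leq_pmull _ _)) // /L expnMn.
  rewrite -expnM (leq_trans _ (leq_pmull _ _)) ?expn_gt0 //.
  by rewrite (expnS K 14) leq_pmulr ?expn_gt0 ?K_gt0.
have ThP u : u \in f @: Om -> [/\ u.1 \in quads A, u.2 \in quads A &
    cross_ratio u.1 = cross_ratio u.2].
  case/imsetP=> -[w x] /setIdP[/= wW xD] ->.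
  by have [wB gw _] := WP w wW; apply: quad_actP.
have [v [Xi [nXi Xi0 Xi1 XiP]]] := cross_ratio_energy An n_gt0 c_gt0 nTh ThP.
rewrite (leq_trans _ (leq_addl _ _)) //.
apply: (many_rich_dilates F_cyclic n_gt0 _ _ _ nXi Xi0 Xi1 XiP).
- by rewrite muln_gt0.
- exact: leq_trans (card_chart _ _) An.
- by rewrite (leq_trans nF) // leq_mul2r K_le_c orbT.
Qed.

End MoebiusBound.

(** * Rows of Pascal's triangle *)

Section PrimeField.

Variable p : nat.
Hypothesis p_pr : prime p.

Lemma Fp_nat_eq0 (m : nat) : ((m%:R : 'F_p) == 0) = (p %| m)%N.
Proof. by rewrite (dvdn_pcharf (pchar_Fp p_pr)). Qed.

Lemma Fp_nat_inj (i j : nat) : (i < p)%N -> (j < p)%N ->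
  (i%:R : 'F_p) = j%:R -> i = j.
Proof.
move=> ip jp e; have := congr1 (@nat_of_ord _) e.
by rewrite !val_Fp_nat // !modn_small.
Qed.

Lemma Fp_cyclic (S : {set 'F_p}) :
  0 \in S -> {in S, forall x, x + 1 \in S} -> S = setT.
Proof.
move=> S0 S1; apply/setP => x; rewrite inE -(natr_Zp x).
by elim: (nat_of_ord x) => [|m IH]; rewrite ?S0 // -natr1 S1.
Qed.

Variable N : nat.
Hypotheses (N_ge2 : (2 <= N)%N) (Np : (N + 3 <= p)%N).

Let a (i : nat) : 'F_p := 'C(N, i)%:R.
Let M : 'F_p := N.+1%:R.
Let A : {set 'F_p} := [set 'C(N, i)%:R | i : 'I_N.+1].
(** In terms of beta = - b / (M + 1), the identity (k a + b) (k c + b) = lambda b^2 with k = M + 1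
    becomes (a - beta) (c - beta) = M^2 beta^2, so that mu = M^2 - 1. *)
Let B : {set 'F_p} := [set - x / (M + 1) | x in A].

Lemma Fp_nat_neq0 (m : nat) : (0 < m < p)%N -> (m%:R : 'F_p) != 0.
Proof.
by case/andP=> m0 mp; rewrite Fp_nat_eq0; apply/negP => /(dvdn_leq m0);
  rewrite leqNgt mp.
Qed.

Lemma prime_ndvd_fact (m : nat) : (m < p)%N -> ~~ (p %| m`!)%N.
Proof.
elim: m => [|m IH] mp; first by rewrite fact0 Euclid_dvd1.
by rewrite factS Euclid_dvdM // negb_or IH ?(ltnW mp) // andbT gtnNdvd.
Qed.

Let N_lt_p : (N.+2 < p)%N. Proof. by move: Np; rewrite addn3. Qed.

Lemma binomial_row_neq0 (i : nat) : (i <= N)%N -> a i != 0.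
Proof.
move=> iN; rewrite Fp_nat_eq0; apply/negP => pd.
have /prime_ndvd_fact/negP[] : (N < p)%N by move: N_lt_p; lia.
by rewrite -(bin_fact iN) dvdn_mulr.
Qed.

Lemma binomial_row_step (i : nat) : (i < N)%N ->
  a i.+1 * i.+1%:R = a i * (M - i.+1%:R).
Proof.
move=> iN; rewrite /M -natrB; last by lia.
rewrite subSS -!natrM; congr (_%:R).
by rewrite mulnC mul_bin_left mulnC.
Qed.

Let M_neq0 : M != 0.
Proof. by apply: Fp_nat_neq0; move: N_lt_p; lia. Qed.

Let M1_neq0 : M + 1 != 0.
Proof. by rewrite natr1 Fp_nat_neq0 //; move: N_lt_p; lia. Qed.

(** Relative to the middle entry, the neighbours are t / (M - t) and (M - t - 1) / (t + 1). Adding 1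
    / (M + 1) turns them into M (t + 1) / ((M - t) (M + 1)) and M (M - t) / ((t + 1) (M + 1)), whose
    product does not depend on t. *)
Lemma binomial_row_swapped (i : nat) : (i.+1 < N)%N ->
  swapped (M ^+ 2 - 1) (- a i.+1 / (M + 1)) (a i) (a i.+2).
Proof.
move=> iN; pose t : 'F_p := i.+1%:R.
have t0 : t != 0 by rewrite Fp_nat_neq0 //; move: N_lt_p; lia.
have t1 : t + 1 != 0.
  by rewrite natr1 Fp_nat_neq0 //; move: N_lt_p; lia.
have Mt : M - t != 0.
  rewrite -natrB; last by lia.
  by apply: Fp_nat_neq0; move: N_lt_p; lia.
have e1 : a i = a i.+1 * t / (M - t).
  by apply: (mulIf Mt); rewrite divfK // binomial_row_step // ltnW.
have e2 : a i.+2 = a i.+1 * (M - (t + 1)) / (t + 1).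
  by apply: (mulIf t1); rewrite divfK // !natr1 binomial_row_step.
apply/eqP; rewrite e1 e2; field.
by rewrite !nat1r; apply/and3P.
Qed.

(** The step relation gives (a i + a i.+1) (i + 1) = a i M with nonzero right side, so two
    neighbouring entries determine i + 1 modulo p. *)
Lemma binomial_pairs_inj (i j : nat) : (i < N)%N -> (j < N)%N ->
  a i = a j -> a i.+1 = a j.+1 -> i = j.
Proof.
move=> iN jN e0 e1.
have si := binomial_row_step iN; have sj := binomial_row_step jN.
apply/succn_inj/Fp_nat_inj; try by move: N_lt_p; lia.
have i0 : (i.+1%:R : 'F_p) != 0 by rewrite Fp_nat_neq0 //; move: N_lt_p; lia.
have nz : a i.+1 + a i != 0.
  apply: contraTneq (mulf_neq0 (binomial_row_neq0 (ltnW iN)) M_neq0).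
  move=> s0; rewrite negbK; apply/eqP; transitivity ((a i.+1 + a i) * i.+1%:R).
    by rewrite mulrDl si; ring.
  by rewrite s0 mul0r.
apply: (mulfI nz); transitivity (a i * M); first by rewrite mulrDl si; ring.
by rewrite e0 e1 mulrDl sj; ring.
Qed.

Lemma binomial_row_mem (i : nat) : (i <= N)%N -> a i \in A.
Proof. by rewrite -ltnS => iN; apply/imsetP; exists (Ordinal iN). Qed.

Lemma binomial_row_sqr : (N.-1 <= #|A| ^ 2)%N.
Proof.
pose f (i : 'I_N.-1) := (a i, a i.+1).
have iN (i : 'I_N.-1) : (i.+1 < N)%N by have := ltn_ord i; lia.
have f_inj : injective f.
  move=> i j e; apply/val_inj/binomial_pairs_inj; try exact/ltnW/iN.
    exact: (congr1 fst e).
  exact: (congr1 snd e).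
rewrite -[leqLHS]card_ord -cardsT -(card_imset _ f_inj) -mulnn -cardsX.
apply/subset_leq_card/subsetP => _ /imsetP[i _ ->].
by rewrite in_setX !binomial_row_mem // ltnW // ltnW.
Qed.

Lemma binomial_row_triples :
  (N.-1 <= #|swap_triples (M ^+ 2 - 1)%R A B|)%N.
Proof.
pose f (i : 'I_N.-1) := (a i, (- a i.+1 / (M + 1), a i.+2)).
have iN (i : 'I_N.-1) : (i.+1 < N)%N by have := ltn_ord i; lia.
have f_inj : injective f.
  move=> i j e; have /(mulIf (invr_neq0 M1_neq0))/oppr_inj e1 :
    - a i.+1 / (M + 1) = - a j.+1 / (M + 1) := congr1 (fst \o snd) e.
  apply/val_inj/binomial_pairs_inj; try exact/ltnW/iN; last exact: e1.
  exact: (congr1 fst e).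
rewrite -[leqLHS]card_ord -cardsT -(card_imset _ f_inj).
apply/subset_leq_card/subsetP => _ /imsetP[i _ ->]; rewrite inE /=.
have h := iN i; rewrite !binomial_row_mem ?(ltnW h) // ?(ltnW (ltnW h)) //=.
rewrite binomial_row_swapped // andbT; apply/imsetP.
by exists (a i.+1) => //; apply: binomial_row_mem; apply: ltnW.
Qed.

Lemma binomial_row_bound (K : nat) : (0 < K)%N ->
  (#|A| ^ 2 <= K * N.-1)%N -> (#|A| <= moebius_const K)%N.
Proof.
move=> K_gt0 AK.
have lam0 : 1 + (M ^+ 2 - 1) != 0 by rewrite addrC subrK expf_neq0.
(* Here mu = N (N + 2), and N + 2 is invertible because N <= p - 3; in row p - 2 it vanishes. *)
have mu0 : M ^+ 2 - 1 != 0.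
  rewrite (_ : _ - 1 = (M - 1) * (M + 1)); last by ring.
  by rewrite mulf_neq0 // /M -natr1 addrK Fp_nat_neq0 //; move: N_lt_p; lia.
have nA i : i \in A -> i != 0.
  by case/imsetP=> k _ ->; apply: binomial_row_neq0; rewrite -ltnS.
have A_gt0 : (0 < #|A|)%N by apply/card_gt0P; exists (a 0); apply/imsetP;
  exists ord0.
apply: (@moebius_bound _ _ mu0 lam0 A B) => //.
- exact: leq_imset_card.
- apply/negP => /imsetP[x /nA x0 /esym/eqP].
  by rewrite mulf_eq0 oppr_eq0 invr_eq0 (negPf x0) (negPf M1_neq0).
- by rewrite (leq_trans AK) // leq_mul2l binomial_row_triples orbT.
- exact: Fp_cyclic.
rewrite (leq_trans AK) // leq_mul2l card_Fp // (leq_trans (leq_pred _)) ?orbT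
  //.
by move: N_lt_p; lia.
Qed.

End PrimeField.

(** * Constants polynomial in K *)

Definition poly_bounded (f : nat -> nat) : Prop :=
  exists C, forall K, (2 <= K)%N -> (f K <= K ^ C)%N.

Lemma poly_bounded_cst (c : nat) : poly_bounded (fun=> c).
Proof. by exists c => K K2; apply/ltnW/ltn_expl. Qed.

Lemma poly_bounded_id : poly_bounded id.
Proof. by exists 1 => K _; rewrite expn1. Qed.

Lemma poly_boundedM (f g : nat -> nat) : poly_bounded f -> poly_bounded g ->
  poly_bounded (fun K => f K * g K)%N.
Proof.
move=> [C fC] [D gD]; exists (C + D)%N => K K2.
by rewrite expnD leq_mul ?fC ?gD.
Qed.

Lemma poly_boundedX (f : nat -> nat) (m : nat) : poly_bounded f ->
  poly_bounded (fun K => f K ^ m)%N.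
Proof.
move=> [C fC]; exists (C * m)%N => K K2; rewrite expnM.
by case: m => // m; rewrite leq_exp2r ?fC.
Qed.

(** The factor 2 of a sum is absorbed by one more factor K, which is where K >= 2 enters. *)
Lemma poly_boundedD (f g : nat -> nat) : poly_bounded f -> poly_bounded g ->
  poly_bounded (fun K => f K + g K)%N.
Proof.
move=> [C fC] [D gD]; exists (C + D).+1%N => K K2.
have K_gt0 : (0 < K)%N by apply: leq_trans K2.
rewrite expnS; apply: (@leq_trans (2 * K ^ (C + D)));
  last by rewrite leq_mul2r K2 orbT.
rewrite mul2n -addnn leq_add //.
  by rewrite (leq_trans (fC K K2)) // leq_pexp2l // leq_addr.
by rewrite (leq_trans (gD K K2)) // leq_pexp2l // leq_addl.
Qed.

Lemma poly_bounded_dilate_const (f g : nat -> nat) :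
    poly_bounded f -> poly_bounded g ->
  poly_bounded (fun K => dilate_const (f K) (g K)).
Proof.
move=> fb gb; rewrite /dilate_const.
by do ![apply: poly_boundedM | apply: poly_boundedX | apply: poly_bounded_cst |
        exact: fb | exact: gb].
Qed.

Lemma poly_bounded_moebius_const : poly_bounded moebius_const.
Proof.
have Lb : poly_bounded (fun K => 128 * K ^ 3)%N.
  apply: poly_boundedM; first exact: poly_bounded_cst.
  exact/poly_boundedX/poly_bounded_id.
have cb : poly_bounded (fun K => 2 * (64 * (128 * K ^ 3) ^ 5))%N.
  apply: poly_boundedM; first exact: poly_bounded_cst.
  apply: poly_boundedM; first exact: poly_bounded_cst.
  exact: poly_boundedX Lb.
rewrite /moebius_const; apply: poly_boundedD.
  apply: poly_boundedD.
    apply: poly_boundedM; first exact: poly_bounded_cst.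
    exact/poly_boundedX/poly_bounded_id.
  by apply: poly_boundedM; [exact: poly_bounded_cst|exact: Lb].
apply: poly_bounded_dilate_const; first exact: cb.
by apply: poly_boundedM; [exact: poly_bounded_cst|exact: poly_boundedX cb].
Qed.

(** From n <= K^C and K (N - 1) <= 3 n^2 one gets n (N - 1)^(C + 1) <= (K (N - 1))^(C + 1) <= 3^(C +
    1) n^(2C + 2), and one n cancels. Raising to integer powers postpones real exponents. *)
Lemma row_residues_nat_bound : exists D : nat, forall p N : nat, prime p ->
  (1 <= N)%N -> (N <= p - 3)%N ->
  (N.+1 ^ D.+1 <= 9 ^ D.+1 * #|row_residues p N| ^ D.*2.+1)%N.
Proof.
have [C KC] := poly_bounded_moebius_const.
exists C => p N p_pr N1 Np; set n := #|_|.
have n_gt0 : (0 < n)%N.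
  by apply/card_gt0P; exists 1; apply/imsetP; exists ord0; rewrite ?bin0.
have [N2|] := ltnP 1 N; last first.
  move=> N2; rewrite (@leq_trans (9 ^ C.+1)) ?leq_pmulr ?expn_gt0 ?n_gt0 //.
  by rewrite leq_exp2r //; lia.
have Np3 : (N + 3 <= p)%N by lia.
(* Adding 2 rounds the quotient up and gives K >= 2. The excess 2 (N - 1) is at most 2 n^2 by
   [binomial_row_sqr], hence the 3 in [KN]. *)
pose K := (n ^ 2 %/ N.-1 + 2)%N.
have N1_gt0 : (0 < N.-1)%N by lia.
have nK : (n ^ 2 <= K * N.-1)%N.
  rewrite /K addn2 (leq_trans (ltnW (ltn_ceil _ N1_gt0))) //.
  by rewrite leq_mul2r ltnW ?orbT.
have KN : (K * N.-1 <= 3 * n ^ 2)%N.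
  have := binomial_row_sqr p_pr N2 Np3; rewrite -/(row_residues p N) -/n.
  rewrite /K mulnDl; have := leq_divM (n ^ 2) N.-1; lia.
have K2 : (2 <= K)%N by rewrite leq_addl.
have nb : (n <= K ^ C)%N.
  apply: leq_trans (KC K K2); apply: (binomial_row_bound p_pr N2 Np3) => //.
  exact: ltnW.
have h1 : (n * N.-1 ^ C.+1 <= n * (3 ^ C.+1 * n ^ C.*2.+1))%N.
  apply: (@leq_trans (K ^ C.+1 * N.-1 ^ C.+1)).
    by rewrite leq_mul2r (leq_trans nb) ?orbT // leq_pexp2l // ltnW.
  rewrite -expnMn (@leq_trans ((3 * n ^ 2) ^ C.+1)) ?leq_exp2r //.
  by rewrite expnMn -expnM mulnCA -expnS -doubleS -mul2n.
rewrite leq_pmul2l // in h1.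
(* For N >= 2, N + 1 <= 3 (N - 1); with the 3 of [KN] this makes 9. *)
apply: (@leq_trans ((3 * N.-1) ^ C.+1)); first by rewrite leq_exp2r //; lia.
rewrite expnMn (leq_trans (leq_mul (leqnn _) h1)) //.
by rewrite mulnA -expnMn.
Qed.

(** * The rows p - 1 and p - 2 *)

Lemma binomial_pred_row (p n : nat) : prime p -> (n <= p.-1)%N ->
  ('C(p.-1, n)%:R : 'F_p) = (-1) ^+ n.
Proof.
move=> p_pr; elim: n => [|n IH] np; first by rewrite bin0.
have p_gt0 := prime_gt0 p_pr.
apply: (addIr 'C(p.-1, n)%:R); rewrite [in RHS]IH ?(ltnW np) // exprS mulN1r
  addNr.
rewrite -natrD -binS prednK //; apply/eqP; rewrite Fp_nat_eq0 //.
by rewrite prime_dvd_bin //=; lia.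
Qed.

Lemma binomial_pred2_row (p n : nat) : prime p -> odd p -> (n <= p.-2)%N ->
  ('C(p.-2, n)%:R : 'F_p) = (-1) ^+ n * n.+1%:R.
Proof.
move=> p_pr p_odd; have := odd_prime_gt2 p_odd p_pr => p_gt2.
elim: n => [|n IH] np; first by rewrite bin0 mulr1.
have e : p.-1 = p.-2.+1 by lia.
apply: (addIr 'C(p.-2, n)%:R); rewrite [in RHS]IH ?(ltnW np) //.
rewrite -natrD -binS -e binomial_pred_row //; last by lia.
by rewrite -(natr1 n.+1) exprS; ring.
Qed.

Lemma card_row_pred (p : nat) : prime p -> odd p ->
  #|row_residues p (p - 1)| = 2%N.
Proof.
move=> p_pr p_odd; have p_gt2 := odd_prime_gt2 p_odd p_pr.
have -> : row_residues p (p - 1) = [set 1; -1].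
  apply/setP => x; rewrite in_set2; apply/imsetP/orP => [[[i ip] _ ->]|] /=.
    rewrite subn1 binomial_pred_row //; last by rewrite -ltnS -subn1.
    by rewrite -signr_odd; case: (odd i); [right|left].
  have lt1 : (1 < (p - 1).+1)%N by lia.
  case=> /eqP ->; [exists ord0|exists (Ordinal lt1)] => //=; rewrite subn1.
    by rewrite bin0.
  by rewrite binomial_pred_row //=; lia.
rewrite cards2 (_ : 1 != -1) //; apply/eqP => e.
have /eqP : (2%:R : 'F_p) = 0 by rewrite (natrD _ 1 1) {2}e subrr.
by rewrite Fp_nat_eq0 // => /dvdn_leq; lia.
Qed.

(** The entry at n is n + 1 for even n and - (n + 1) = p - n - 1 for odd n. As p is odd, both are
    odd numbers below p, and even n already give all of 1, 3, ..., p - 2. *)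
Lemma card_row_pred2 (p : nat) : prime p -> odd p ->
  #|row_residues p (p - 2)| = ((p - 1) %/ 2)%N.
Proof.
move=> p_pr p_odd; have p_gt2 := odd_prime_gt2 p_odd p_pr.
pose f (i : 'I_((p - 1) %/ 2)) : 'F_p := i.*2.+1%:R.
have ip (i : 'I_((p - 1) %/ 2)) : (i.*2.+1 < p)%N by have := ltn_ord i; lia.
have f_inj : injective f.
  move=> i j /(Fp_nat_inj p_pr (ip i) (ip j)) /succn_inj /double_inj.
  exact: val_inj.
rewrite -[RHS]card_ord -cardsT -(card_imset _ f_inj); apply: eq_card => x.
apply/imsetP/imsetP => [[[i iN'] _ ->]|[i _ ->]] /=.
  have iN : (i <= p.-2)%N by lia.
  rewrite (_ : p - 2 = p.-2)%N ?binomial_pred2_row //; last by lia.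
  rewrite -signr_odd; have [io|ie] := boolP (odd i).
    have lt : ((p - i - 2)./2 < (p - 1) %/ 2)%N by lia.
    exists (Ordinal lt) => //; rewrite /f /=.
    apply/eqP; rewrite expr1 mulN1r eq_sym -subr_eq0 opprK -natrD Fp_nat_eq0 //.
    by rewrite (_ : _ + _ = p)%N ?dvdnn //; lia.
  have lt : (i./2 < (p - 1) %/ 2)%N by lia.
  by exists (Ordinal lt) => //; rewrite /f /= mul1r; congr (_%:R); lia.
have lt : (i.*2 < (p - 2).+1)%N by have := ip i; lia.
exists (Ordinal lt) => //=; rewrite (_ : p - 2 = p.-2)%N; last by lia.
rewrite binomial_pred2_row //; last by lia.
by rewrite -signr_odd odd_double mul1r.
Qed.

(* Passage to real exponents *)
From mathcomp Require Import all_classical all_reals all_analysis.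

Lemma row_residues_powR_bound (R : realType) : exists c eta : R,
  [/\ 0 < c, 0 < eta & forall p N : nat, prime p -> (1 <= N)%N ->
    (N <= p - 3)%N ->
    c * N.+1%:R `^ (1 / 2 + eta) <= #|row_residues p N|%:R].
Proof.
have [D DP] := row_residues_nat_bound.
pose d : R := D.*2.+1%:R; have d_gt0 : 0 < d by rewrite ltr0n.
have d0 : d != 0 by rewrite gt_eqF.
pose th : R := D.+1%:R / d.
have thE : 1 / 2 + (2 * d)^-1 = th.
  have dE : d = 2 * D.+1%:R - 1.
    by rewrite /d -natr1 -mul2n natrM -natr1; ring.
  rewrite /th; have -> : (D.+1%:R : R) = (d + 1) / 2 by rewrite dE; field.
  by field.
(* Taking the root of order d = 2D + 1 of the integer bound gives the exponent th = (D + 1) / (2D +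
   1) = 1/2 + 1 / (2d). *)
exists (9 `^ th)^-1, (2 * d)^-1; rewrite thE.
split; first by rewrite invr_gt0 powR_gt0.
  by rewrite invr_gt0 mulr_gt0.
move=> p N p_pr N1 Np; rewrite mulrC ler_pdivrMr ?powR_gt0 //.
set n := #|_|; have := DP p N p_pr N1 Np; rewrite -/n.
rewrite -(ler_nat R) natrM !natrX => h.
have root (x : R) : 0 <= x -> (x ^+ D.+1) `^ d^-1 = x `^ th.
  by move=> x0; rewrite -powR_mulrn // -powRrM.
have rootn : (n%:R ^+ D.*2.+1) `^ d^-1 = n%:R :> R.
  by rewrite -powR_mulrn ?ler0n // -powRrM mulfV // powRr1.
have : (N.+1%:R ^+ D.+1) `^ d^-1 <= (9 ^+ D.+1 * n%:R ^+ D.*2.+1) `^ d^-1.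
  apply: ge0_ler_powR => //; first by rewrite invr_ge0 ltW.
    by rewrite nnegrE exprn_ge0.
  by rewrite nnegrE mulr_ge0 ?exprn_ge0.
by rewrite powRM ?exprn_ge0 // !root // rootn mulrC.
Qed.

Theorem theorem1p4 (R : realType) :
  (exists c eta : R,
     [/\ 0 < c,
         0 < eta
       & forall p N : nat,
           prime p ->
           (1 <= N)%N ->
           (N <= p - 3)%N ->
           c * N.+1%:R `^ (1 / 2 + eta) <= #|row_residues p N|%:R])
  /\
  (forall p : nat,
     prime p ->
     odd p ->
     #|row_residues p (p - 2)| = ((p - 1) %/ 2)%N
     /\ #|row_residues p (p - 1)| = 2%N).
Proof.
split; first exact: row_residues_powR_bound.
by move=> p p_pr p_odd; rewrite card_row_pred2 ?card_row_pred.
Qed.
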